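(* For infinite time Turing machines, $P \subsetneq \mathrm{NP}\cap\text{co-NP}$; that is, $P\subseteq \mathrm{NP}\cap\text{co-NP}$ and $P\neq \mathrm{NP}\cap\text{co-NP}$.
   Context: Infinite time Turing machines (ITTMs) have the hardware of a classical Turing machine with finitely many semi-infinite binary tapes (input tape(s), scratch tape, output tape), one head and a finite program. They run in transfinite ordinal time: successor steps are as in the classical case; at a limit stage the head returns to the leftmost cell, the machine enters a special limit state, and each cell takes the $\limsup$ of its earlier values. Reals are elements of Cantor space ${}^\omega 2$, denoted $\mathbb{R}$. To decide a set $A\subseteq\mathbb{R}$ a machine uses two halting states, accept and reject; a computation halts in $\alpha$ steps if its $\alpha$-th step moves into a halting state. For nondeterministic classes the witness $y$ is supplied on a separate input tape. For an ordinal $\alpha$: $A\in P_\alpha$ iff there are a machine $T$ and an ordinal $\beta<\alpha$ such that $T$ decides $A$ and halts on every input in fewer than $\beta$ steps; $A\in \mathrm{NP}_\alpha$ iff there are $T$ and $\beta<\alpha$ such that for all $x$, $x\in A\iff \exists y\in\mathbb{R}$ with $T$ accepting $(x,y)$, and $T$ halts on every input $(x,y)$ in fewer than $\beta$ steps; $\text{co-NP}_\alpha$ is the class of complements of sets in $\mathrm{NP}_\alpha$. Finally $P=P_{\omega^\omega}$, $\mathrm{NP}=\mathrm{NP}_{\omega^\omega}$, $\text{co-NP}=\text{co-NP}_{\omega^\omega}$ (ordinal exponentiation). *)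

(* Defs.v *)
From mathcomp Require Import all_boot.
From mathcomp Require Import boolp classical_sets cardinality.

Set Implicit Arguments.
Unset Strict Implicit.
Unset Printing Implicit Defensive.

Local Open Scope classical_set_scope.

(** An ordinal is represented by a well-ordered type [a] of that order type;
    the ordinals below it are represented by the elements of [a]. *)
Record ordinal_rep := OrdinalRep {
  ocarrier :> Type;
  olt : ocarrier -> ocarrier -> Prop;
  olt_wf : well_founded olt;
  olt_trans : forall s t u, olt s t -> olt t u -> olt s u;
  olt_total : forall s t, [\/ olt s t, s = t | olt t s]
}.

Definition ole (a : ordinal_rep) (s t : a) : Prop := olt s t \/ s = t.

Definition is_ozero (a : ordinal_rep) (t : a) : Prop := forall s : a, ~ olt s t.

Definition is_osucc (a : ordinal_rep) (s t : a) : Prop :=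
  olt s t /\ forall u : a, ~ (olt s u /\ olt u t).

Definition is_olimit (a : ordinal_rep) (t : a) : Prop :=
  ~ is_ozero t /\ forall s : a, ~ is_osucc s t.

Lemma olt_irr (a : ordinal_rep) (s : a) : ~ olt s s.
Proof.
by elim/(well_founded_ind (@olt_wf a)): s => s IHs ss; exact: (IHs s ss ss).
Qed.

Fact ltn_wf : well_founded (fun m n => (m < n)%N).
Proof. by elim/ltn_ind => n IHn; constructor. Qed.

Fact ltn_total m n : [\/ (m < n)%N, m = n | (n < m)%N].
Proof. by case: (ltngtP m n) => h; [constructor 1|constructor 3|constructor 2]. Qed.

Definition omega : ordinal_rep :=
  OrdinalRep ltn_wf (fun s t u => @ltn_trans t s u) ltn_total.

(** Ordinal exponentiation [a ^ b]: finitely supported functions from [b] to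
    [a], compared at the largest argument at which they differ. *)
Section OrdinalExponentiation.
Variables a b : ordinal_rep.

Definition finsupp (f : b -> a) : Prop :=
  finite_set [set i : b | ~ is_ozero (f i)].

Definition oexp_car : Type := {f : b -> a | finsupp f}.

Definition oexp_lt (f g : oexp_car) : Prop :=
  exists i : b, olt (sval f i) (sval g i) /\
    forall j : b, olt i j -> sval f j = sval g j.

Let has_max (D : set b) : finite_set D -> (exists i, D i) ->
  exists i, D i /\ forall j, olt i j -> ~ D j.
Proof.
move=> /(@finite_seqP {classic b})[l]; elim: l D => [|x l IHl] D -> [i0 Di0] //.
have [[j [xj Dj]]|nD] := pselect (exists j, olt x j /\ j \in (l : seq {classic b})).
  have [|i [li maxi]] := IHl _ erefl; first by exists j.
  have [ix|xi] := pselect (olt i x).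
    by case: (maxi _ (olt_trans ix xj)).
  exists i; split=> [/=|k ik]; first by rewrite inE li orbT.
  rewrite /= inE => /orP[/eqP kx|]; last exact: maxi.
  by apply: xi; rewrite -kx.
exists x; split=> [/=|k xk]; first by rewrite inE eqxx.
rewrite /= inE => /orP[/eqP kx|kl]; last by apply: nD; exists k.
by move: xk; rewrite kx => /olt_irr.
Qed.

Let supp (f : b -> a) (i : b) := exists c, olt c (f i).

Let suppE f i : supp f i <-> ~ is_ozero (f i).
Proof.
split=> [[c cf] /(_ c)//|nz]; apply: contrapT => ns; apply: nz => c cf.
by apply: ns; exists c.
Qed.

Let finsuppU (f g : oexp_car) (p : set b) :
  (forall i, p i -> ~ is_ozero (sval f i) \/ ~ is_ozero (sval g i)) -> finite_set p.
Proof.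
move=> hp; apply: (@sub_finite_set _ _ ([set i | ~ is_ozero (sval f i)] `|`
  [set i | ~ is_ozero (sval g i)]) hp).
by rewrite finite_setU; split; [exact: (svalP f)|exact: (svalP g)].
Qed.

Let supp_max (f : oexp_car) : (exists i, supp (sval f) i) ->
  exists i, supp (sval f) i /\ forall j, olt i j -> ~ supp (sval f) j.
Proof.
apply: has_max; apply: sub_finite_set (svalP f) => i; exact: (suppE _ i).1.
Qed.

Let acc_zero (f : oexp_car) : ~ (exists i, supp (sval f) i) -> Acc oexp_lt f.
Proof. by move=> f0; constructor=> g [i [gf _]]; case: f0; exists i, (sval g i). Qed.

Let supp_le (f : oexp_car) i := forall j, supp (sval f) j -> ole j i.
Let supp_lt (f : oexp_car) i := forall j, supp (sval f) j -> olt j i.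

Let max_le (f : oexp_car) i :
  (forall j, olt i j -> ~ supp (sval f) j) -> supp_le f i.
Proof.
move=> maxi j fj; case: (olt_total j i) => [||ij]; [by left|by right|].
by case: (maxi j ij).
Qed.

Let restrict (f : oexp_car) (i : b) : (exists x : a, True) ->
  exists h : oexp_car, supp_lt h i /\ forall j, olt j i -> sval h j = sval f j.
Proof.
case=> x0 _.
have [z zmin] : exists z : a, is_ozero z.
  elim/(well_founded_ind (@olt_wf a)): x0 => x IHx.
  by have [[y /IHx]|n] := pselect (exists y, olt y x); last by exists x => y yx; apply: n; exists y.
pose h j := if pselect (olt j i) then sval f j else z.
have hfs : finsupp h.
  apply: sub_finite_set (svalP f) => j /=; rewrite /h.
  by case: pselect.
exists (exist _ h hfs); split=> [j [c]|j] /=; rewrite /h.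
- by case: pselect => // _ /zmin.
- by case: pselect.
Qed.

Let oexp_wf : well_founded oexp_lt.
Proof.
suff main i f : supp_le f i -> Acc oexp_lt f.
  move=> f; have [/supp_max[i [_ /max_le/main//]]|/acc_zero//] :=
    pselect (exists i, supp (sval f) i).
elim/(well_founded_ind (@olt_wf b)): i f => i IHi.
have acc_lt f : supp_lt f i -> Acc oexp_lt f.
  move=> fi; have [/supp_max[j [/fi ji /max_le fj]]|/acc_zero//] :=
    pselect (exists j, supp (sval f) j).
  exact: IHi ji _ fj.
suff aux c h : Acc oexp_lt h -> forall f, sval f i = c -> supp_le f i ->
    (forall j, olt j i -> sval h j = sval f j) -> Acc oexp_lt f.
  move=> f fi; have [h [hi hf]] := @restrict f i (ex_intro _ (sval f i) I).
  exact: (aux _ h (acc_lt _ hi) f erefl fi hf).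
elim/(well_founded_ind (@olt_wf a)): c h => c IHc h.
elim=> {}h _ IHh f fic fi hf; constructor=> g [k [gfk gf]].
have ki : ole k i by apply: fi; exists (sval g k).
have gi : supp_le g i.
  move=> j [d dgj]; case: (olt_total k j) => [kj||jk].
  - by apply: fi; exists d; rewrite -gf.
  - by move=> <-.
  - by left; case: ki => [/(olt_trans jk)//|<-].
case: ki => [ki|ki].
  have gfi : sval g i = c by rewrite gf.
  pose p j := if pselect (olt j i) then sval g j else sval h j.
  have pfs : finsupp p.
    apply: (finsuppU (f := g) (g := h)) => j /=.
    by rewrite /p; case: pselect; [left|right].
  apply: (IHh (exist _ p pfs)) gfi gi _.
    exists k; split=> [|j kj] /=; rewrite /p; case: pselect => // ji.
      by rewrite hf.
    by rewrite hf // gf.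
  by move=> j ji /=; rewrite /p; case: pselect.
have [h' [h'i h'g]] := @restrict g i (ex_intro _ (sval g i) I).
apply: (IHc (sval g i) _ h' (acc_lt _ h'i)) => //.
by rewrite -fic -ki.
Qed.

Let oexp_trans f g h : oexp_lt f g -> oexp_lt g h -> oexp_lt f h.
Proof.
move=> [i [fgi fg]] [j [ghj gh]]; case: (olt_total i j) => [ij|ij|ji].
- exists j; split=> [|k jk]; first by rewrite fg.
  by rewrite fg ?gh//; exact: olt_trans ij jk.
- subst j; exists i; split=> [|k ik]; first exact: olt_trans fgi ghj.
  by rewrite fg ?gh.
- exists i; split=> [|k ik]; first by rewrite -gh.
  by rewrite fg ?gh//; exact: olt_trans ji ik.
Qed.

Let oexp_total f g : [\/ oexp_lt f g, f = g | oexp_lt g f].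
Proof.
have [fg|fg] := pselect (forall i, sval f i = sval g i).
  constructor 2; case: f g fg => [f hf] [g hg] /= /funext fg.
  by move: hf hg; rewrite fg => hf hg; rewrite (Prop_irrelevance hf hg).
have [||i [fgi maxi]] := @has_max (fun i => sval f i <> sval g i).
- apply: (finsuppU (f := f) (g := g)).
  move=> i fgi; case: (olt_total (sval f i) (sval g i)) => // lt_i.
  + by right; apply/suppE; exists (sval f i).
  + by left; apply/suppE; exists (sval g i).
- by apply/not_existsP => nfg; apply: fg => i; apply: contrapT; exact: nfg.
have {}maxi j : olt i j -> sval f j = sval g j.
  by move=> ij; apply: contrapT; exact: maxi.
case: (olt_total (sval f i) (sval g i)) => // lt_i.
- by constructor 1; exists i.
- by constructor 3; exists i; split=> // j /maxi.
Qed.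

Definition oexp : ordinal_rep := OrdinalRep oexp_wf oexp_trans oexp_total.

End OrdinalExponentiation.

Definition real : Type := nat -> bool.

Inductive tape (k : nat) := Input of 'I_k | Scratch | Output.
Arguments Scratch {k}.
Arguments Output {k}.

Inductive move := MoveLeft | MoveRight.

Inductive state (Q : Type) := Start | Limit | Accept | Reject | Aux of Q.
Arguments Start {Q}.
Arguments Limit {Q}.
Arguments Accept {Q}.
Arguments Reject {Q}.

Definition halting (Q : Type) (q : state Q) : Prop := q = Accept \/ q = Reject.

(** [program q r] gives the new state, the symbols written under the head and
    the move, when the machine is in state [q] and reads [r t] on tape [t].
    It has a finite domain, hence is a finite table; its entries at [Accept]
    and [Reject] are never consulted. *)
Record ittm (k : nat) := ITTM {
  aux_state : finType;
  program : state aux_state -> (tape k -> bool) ->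
            state aux_state * (tape k -> bool) * move
}.

(** The single head scans the cells at position [head] of all the tapes. *)
Record config (k : nat) (Q : Type) := Config {
  cstate : state Q;
  head : nat;
  cells : tape k -> nat -> bool
}.

Section Computation.
Variables (k : nat) (T : ittm k).
Local Notation conf := (config k (aux_state T)).

Definition initial (x : k.-tuple real) : conf :=
  Config Start 0
    (fun t n => match t with Input i => tnth x i n | _ => false end).

(** A left move from the leftmost cell leaves the head in place ([0.-1 = 0]). *)
Definition step (c : conf) : conf :=
  let: (q, w, m) := program (cstate c) (fun t => cells c t (head c)) in
  Config q (match m with MoveLeft => (head c).-1 | MoveRight => (head c).+1 end)
    (fun t n => if n == head c then w t else cells c t n).

Variable a : ordinal_rep.

(** [limsup_at u t v]: the [limsup] of the bits [u s] as [s] tends to the limit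
    [t], that is [inf_(r < t) sup_(r <= s < t) u s], is [v]. *)
Definition limsup_at (u : a -> bool) (t : a) (v : bool) : Prop :=
  v = true <->
  forall r : a, olt r t -> exists s : a, [/\ ole r s, olt s t & u s = true].

Definition stage_ok (x : k.-tuple real) (c : a -> conf) (t : a) : Prop :=
  [/\ is_ozero t -> c t = initial x,
      forall s : a, is_osucc s t -> c t = step (c s)
    & is_olimit t ->
      [/\ cstate (c t) = Limit, head (c t) = 0
        & forall i n, limsup_at (fun s => cells (c s) i n) t (cells (c t) i n)]].

(** The step performed at stage [t] is the [t]-th one: it is the first step
    moving into a halting state, and that state is [q]. *)
Definition halts_in (x : k.-tuple real) (t : a) (q : state (aux_state T)) : Prop :=
  exists c : a -> conf,
    [/\ forall s, ole s t -> stage_ok x c s,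
        forall s, ole s t -> ~ halting (cstate (c s)),
        cstate (step (c t)) = q
      & halting q].

Definition accepts (x : k.-tuple real) : Prop := exists t : a, halts_in x t Accept.

Definition rejects (x : k.-tuple real) : Prop := exists t : a, halts_in x t Reject.

Definition halts_before (x : k.-tuple real) (b : a) : Prop :=
  exists t q, olt t b /\ halts_in x t q.

End Computation.

Definition decides (a : ordinal_rep) (T : ittm 1) (A : set real) : Prop :=
  forall x : real, (A x -> accepts T a [tuple x]) /\ (~ A x -> rejects T a [tuple x]).

Definition P_ (a : ordinal_rep) : set (set real) :=
  [set A | exists (T : ittm 1) (b : a),
     decides a T A /\ forall x : real, halts_before T [tuple x] b].

Definition NP_ (a : ordinal_rep) : set (set real) :=
  [set A | exists (T : ittm 2) (b : a),
     (forall x : real, A x <-> exists y : real, accepts T a [tuple x; y]) /\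
     forall x y : real, halts_before T [tuple x; y] b].

Definition coNP_ (a : ordinal_rep) : set (set real) :=
  [set ~` A | A in NP_ a].

Definition P : set (set real) := P_ (oexp omega omega).
Definition NP : set (set real) := NP_ (oexp omega omega).
Definition coNP : set (set real) := coNP_ (oexp omega omega).

(* Main.v *)
Require Import Defs.
From mathcomp Require Import all_boot.
From mathcomp Require Import boolp classical_sets cardinality.
From mathcomp Require Import zify.

(** A real [x] is read as a countable graph whose vertices carry ordinals below
    [omega ^ omega], together with a set of marked vertices.  Orienting each edge
    downwards, well-foundedness gives a unique "kernel": the set of vertices with no
    lower neighbour in the set.  Let [diag] be the set of [x] such that some marked
    vertex is in the kernel of [x].

    The kernel condition computes countable NOR circuits.  The bits of a computation
    at stage [t] are given by a circuit of rank about [omega * t]; wiring into [x] the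
    circuit "[T] does not accept", with leaves reading [x] itself, gives
    [x \in diag] iff [T] does not accept [x], so [diag] is not in [P].

    On the other hand both [diag] and its complement are in [NP]: the witness is the
    kernel, and it is checked in about [omega ^ 2] steps.  The [m]-th sweep over the
    tapes compares vertex [m] with all the other ones; the graph has an edge
    [{m, d}] when bit [m + d] of a sequence is set, so that shifting this sequence by one
    cell in each sweep puts the relevant bit at position [d]. *)

Set Implicit Arguments.
Unset Strict Implicit.
Unset Printing Implicit Defensive.

Local Open Scope classical_set_scope.

(* [seq.head] shadows the head position of a configuration. *)
Local Notation head := Defs.head.

(** * Ordinals *)

Section Order.
Variable a : ordinal_rep.
Implicit Types r s t : a.

Lemma nolt s t : ~ olt s t <-> ole t s.
Proof.
split=> [ns|[ts|->] st]; last exact: olt_irr st.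
- by case: (olt_total s t) => //; [right|left].
- exact: olt_irr (olt_trans st ts).
Qed.

Lemma ole_olt_trans s r t : ole r s -> olt s t -> olt r t.
Proof. by move=> [rs|->]//; exact: olt_trans. Qed.

Lemma olt_ole_trans s r t : olt r s -> ole s t -> olt r t.
Proof. by move=> rs [|<-]//; exact: olt_trans. Qed.

Lemma ole_trans s r t : ole r s -> ole s t -> ole r t.
Proof. by move=> [rs|->]// st; left; exact: olt_ole_trans st. Qed.

Lemma oleP s t : ole s t \/ olt t s.
Proof. by case: (olt_total s t); [left; left|left; right|right]. Qed.

Lemma osucc_ole s t r : is_osucc s t -> olt r t -> ole r s.
Proof.
by move=> [_ st] rt; case: (oleP r s) => // sr; case: (st r).
Qed.

Lemma osucc_inj s s' t : is_osucc s t -> is_osucc s' t -> s = s'.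
Proof.
move=> st s't; have [ss'|//] := osucc_ole s't st.1.
by case: (st.2 s'); split=> //; exact: s't.1.
Qed.

Lemma stage_cases t : [\/ is_ozero t, exists s, is_osucc s t | is_olimit t].
Proof.
have [t0|t0] := pselect (is_ozero t); first by constructor 1.
have [ts|ts] := pselect (exists s, is_osucc s t); first by constructor 2.
by constructor 3; split=> // s st; apply: ts; exists s.
Qed.

End Order.

Local Notation Om := (oexp omega omega).

Lemma finsuppP (f : nat -> nat) :
  @finsupp omega omega f <-> exists N, forall i, N <= i -> f i = 0.
Proof.
split=> [/finite_seqP[l lE]|[N fN]].
  exists (\max_(i <- l) i).+1 => i; case fi: (f i) => [//|n] li.
  suff : i \in l by move=> /(@leq_bigmax_seq _ l xpredT (fun i => i) i) /(_ erefl); lia.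
  have : [set` l] i by rewrite -lE /= /is_ozero /= fi => /(_ 0); lia.
  by [].
apply: sub_finite_set (finite_II N) => i /= fi; rewrite ltnNge; apply/negP => /fN f0.
by apply: fi => s /=; rewrite f0.
Qed.

(** An element of [Om] is a Cantor normal form; [coef t i] is its coefficient at [omega ^ i]. *)
Definition coef (t : Om) : nat -> nat := sval t.

Lemma coef_inj s t : coef s =1 coef t -> s = t.
Proof.
case: s t => [f hf] [g hg] /= /funext fg.
by move: hf hg; rewrite /= fg => hf hg; rewrite (Prop_irrelevance hf hg).
Qed.

Lemma coef_fin (t : Om) : exists N, forall i, N <= i -> coef t i = 0.
Proof. exact/finsuppP/(svalP t). Qed.

Lemma oltE (s t : Om) : olt s t <->
  exists i, coef s i < coef t i /\ forall j, i < j -> coef s j = coef t j.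
Proof. by []. Qed.

Definition mkOm (f : nat -> nat) (h : exists N, forall i, N <= i -> f i = 0) : Om :=
  exist _ f ((finsuppP f).2 h).

Fact osuc_fin (t : Om) :
  exists N, forall i, N <= i -> (if i is 0 then (coef t 0).+1 else coef t i) = 0.
Proof. by have [N tN] := coef_fin t; exists N.+1 => -[|i] // /ltnW/tN. Qed.

Fact omul_fin (t : Om) :
  exists N, forall i, N <= i -> (if i is i'.+1 then coef t i' else 0) = 0.
Proof. by have [N tN] := coef_fin t; exists N.+1 => -[|i] // /tN. Qed.

Fact ozero_fin : exists N, forall i, N <= i -> (fun=> 0) i = 0 :> nat.
Proof. by exists 0. Qed.

Definition osuc (t : Om) : Om := mkOm (osuc_fin t).
(* Left multiplication by [omega]. *)
Definition omul (t : Om) : Om := mkOm (omul_fin t).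
Definition ozero : Om := mkOm ozero_fin.

Lemma olt0 (t : Om) : ~ olt t ozero.
Proof. by move=> /oltE[i []]. Qed.

Lemma ole0 (t : Om) : ole ozero t.
Proof. by apply/nolt/olt0. Qed.

Lemma olt_osuc (s t : Om) : olt s (osuc t) <-> ole s t.
Proof.
split=> [/oltE[i [sti st]]|[/oltE[i [sti st]]|->]]; last by apply/oltE; exists 0; split=> // -[].
- case: i sti st => [|i] /= sti st; last by left; apply/oltE; exists i.+1; split=> // -[|j]//; exact: st.
  case: (ltngtP (coef s 0) (coef t 0)) => [lt0||eq0]; last 1 first.
  + by right; apply: coef_inj => -[|i]//; rewrite st.
  + by left; apply/oltE; exists 0; split=> // -[|j]//; exact: st.
  + by move: sti; rewrite ltnS; lia.
- apply/oltE; exists i; split=> [|[|j]// /st//].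
  by clear st; case: i sti => //= sti; rewrite ltnS ltnW.
Qed.

Lemma osuc_lt (s t : Om) : olt (osuc s) (osuc t) <-> olt s t.
Proof.
rewrite olt_osuc; split=> [h|st].
- by apply: olt_ole_trans h; apply/olt_osuc; right.
- by apply/nolt => /olt_osuc/nolt.
Qed.

Lemma omul_lt (s t : Om) : olt (omul s) (omul t) <-> olt s t.
Proof.
split=> /oltE[i [sti st]]; apply/oltE.
- case: i sti st => // i sti st; exists i; split=> // j ij.
  exact: (st j.+1).
- by exists i.+1; split=> // -[|j]// ij; exact: st.
Qed.

Lemma osuc_omul_lt (s t : Om) : olt (osuc s) (omul t) <-> olt s (omul t).
Proof.
split=> [|/oltE[[|i] [sti st]]] //; first by apply: olt_trans; apply/olt_osuc; right.
by apply/oltE; exists i.+1; split=> // -[|j]// ij; exact: st.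
Qed.

Lemma omul_inj s t : omul s = omul t -> s = t.
Proof. by move=> /(congr1 coef) st; apply: coef_inj => i; have := congr1 (@^~ i.+1) st. Qed.

Lemma omul0 : omul ozero = ozero.
Proof. by apply: coef_inj => -[|i]. Qed.

Lemma omul_gt0 t : olt ozero (omul t) <-> olt ozero t.
Proof. by rewrite -{1}omul0 omul_lt. Qed.

Lemma osuc_gt0 t : olt ozero (osuc t).
Proof. by rewrite olt_osuc; exact: ole0. Qed.

(** This is [omega * u + j]. It serves as a circuit rank, layer [j] above level [u], and as a stage,
    step [j] of sweep [u]. *)
Definition rk (u : Om) (j : nat) : Om := iter j osuc (omul u).

Lemma coef_iter_osuc j t i :
  coef (iter j osuc t) i = if i is 0 then j + coef t 0 else coef t i.
Proof.
elim: j i => [|j IHj] [|i] //=.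
by rewrite (IHj 0). Qed.

Lemma rk_surj t : exists u j, t = rk u j.
Proof.
have h : exists N, forall i, N <= i -> coef t i.+1 = 0.
  by have [N tN] := coef_fin t; exists N => i Ni; apply: tN; exact: leqW.
exists (mkOm h), (coef t 0); apply: coef_inj => i.
by rewrite coef_iter_osuc; case: i => //=; rewrite addn0.
Qed.

Lemma rkS u j : rk u j.+1 = osuc (rk u j). Proof. by []. Qed.

Lemma rk_lt u j v k : olt (rk u j) (rk v k) <-> olt u v \/ (u = v /\ j < k).
Proof.
split=> [/oltE[i]|[uv|[<- jk]]].
- rewrite /rk !coef_iter_osuc => -[]; case: i => [|i] uvi uv.
  + right; split; last by move: uvi => /=; lia.
    by apply: omul_inj; apply: coef_inj => -[|i]//; have := uv i.+1 isT; rewrite !coef_iter_osuc.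
  + left; apply/omul_lt/oltE; exists i.+1; split=> // -[|n]// ij.
    by have := uv n.+1 ij; rewrite !coef_iter_osuc.
- move/omul_lt/oltE: uv => [[|i] [uvi uv]] //.
  apply/oltE; exists i.+1; rewrite /rk !coef_iter_osuc; split=> // -[|n]// /uv.
  by rewrite !coef_iter_osuc.
- apply/oltE; exists 0; rewrite /rk !coef_iter_osuc; split=> [|[|n]// _]; first by rewrite ltn_add2r.
  by rewrite !coef_iter_osuc.
Qed.

Lemma rk_le u j v k : ole (rk u j) (rk v k) <-> olt u v \/ (u = v /\ j <= k).
Proof. by rewrite -olt_osuc -rkS rk_lt. Qed.

Lemma lt_rk0 t u : olt t (rk u 0) -> exists v j, olt v u /\ t = rk v j.
Proof.
by have [v [j ->]] := rk_surj t => /rk_lt[vu|[]//]; exists v, j.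
Qed.

Lemma osuc_is_osucc t : is_osucc t (osuc t).
Proof.
split=> [|u [tu /olt_osuc ut]]; first by apply/olt_osuc; right.
exact: (nolt t u).2 ut tu.
Qed.

Lemma ozero_is_ozero : is_ozero ozero.
Proof. exact: olt0. Qed.

Lemma is_osucc_eq (s t : Om) : is_osucc s t -> t = osuc s.
Proof.
move=> st; case: (olt_total t (osuc s)) => // [/olt_osuc/nolt|h].
  by case: st.
case: (st.2 (osuc s)); split=> //; exact: (osuc_is_osucc s).1.
Qed.

Lemma omul_limit u : olt ozero u -> is_olimit (omul u).
Proof.
move=> u0; split=> [z|s /is_osucc_eq/(congr1 (coef^~ 0))//].
by case: (z ozero); apply/omul_gt0.
Qed.

(* The constant coefficient comes first. *)
Fixpoint oval (s : seq nat) : Om := if s is n :: s' then rk (oval s') n else ozero.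

(** Through it stages are indexed by the countable type [seq nat], as the inputs of a gate must
    be. *)
Lemma oval_surj t : exists s, t = oval s.
Proof.
have [N] := coef_fin t; elim: N t => [|N IHN] t tN.
  by exists [::]; apply: coef_inj => i; rewrite tN.
have [u [j tE]] := rk_surj t; have [|s us] := IHN u.
  move=> i Ni; have := tN i.+1 Ni.
  by rewrite tE coef_iter_osuc.
by exists (j :: s); rewrite tE us.
Qed.

(** * Runs *)

Section Run.
Variables (k : nat) (T : ittm k) (a : ordinal_rep) (x : k.-tuple real).
Local Notation conf := (config k (aux_state T)).

(** The recursion ignores halting, so that the run is defined at every stage; halting is read off
    afterwards by [halts_inE]. *)
Definition run_body (t : a) (rec : forall s, olt s t -> conf) : conf :=
  if pselect (is_ozero t) then initial T x else
  match pselect (exists s, is_osucc s t) with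
  | left ex => let: exist s st := cid ex in step (rec s st.1)
  | right _ => Config Limit 0 (fun i n => `[< forall r, olt r t ->
      exists s (st : olt s t), ole r s /\ cells (rec s st) i n = true >])
  end.

Definition run : a -> conf := Fix (@olt_wf a) (fun=> conf) run_body.

Let runE t : run t = @run_body t (fun s _ => run s).
Proof.
rewrite /run Fix_eq // => t' f g fg; suff -> : f = g by [].
by do 2![apply: functional_extensionality_dep; move=> ?].
Qed.

Lemma run0 t : is_ozero t -> run t = initial T x.
Proof. by rewrite runE /run_body; case: (pselect (is_ozero t)). Qed.

Lemma runS s t : is_osucc s t -> run t = step (run s).
Proof.
move=> st; rewrite runE /run_body; case: (pselect (is_ozero t)) => [t0|nt0] /=.
  by case: (t0 s); exact: st.1.
case: pselect => [ex|]; last by case; exists s.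
by case: cid => s' s't; rewrite (osucc_inj s't st).
Qed.

Lemma run_limit t : is_olimit t -> run t = Config Limit 0 (fun i n =>
  `[< forall r, olt r t -> exists s, [/\ ole r s, olt s t & cells (run s) i n = true] >]).
Proof.
move=> lt; rewrite runE /run_body; case: (pselect (is_ozero t)) => [/lt.1//|nt0] /=.
case: pselect => [[s /lt.2]//|_].
congr (Config _ _); apply: funext => i; apply: funext => n.
apply: asbool_equiv_eq; split=> h r /h.
- by move=> [s [st [rs sv]]]; exists s.
- by move=> [s [rs st sv]]; exists s, st.
Qed.

Lemma run_ok t : stage_ok x run t.
Proof.
split; [exact: run0|by move=> s; exact: runS|move=> /run_limit ->].
split=> // i n; rewrite /limsup_at /=; split=> [/asboolP//|h]; exact/asboolP.
Qed.

Lemma run_unique (c : a -> conf) t :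
  (forall s, ole s t -> stage_ok x c s) -> forall s, ole s t -> c s = run s.
Proof.
move=> ok; elim/(well_founded_ind (@olt_wf a)) => s IHs st.
have IH r : olt r s -> c r = run r.
  by move=> rs; apply: IHs => //; left; exact: olt_ole_trans st.
have [c0 cS cL] := ok s st; case: (stage_cases s) => [s0|[r rs]|sl].
- by rewrite c0// run0.
- by rewrite (cS _ rs) (runS rs) IH//; exact: rs.1.
- rewrite run_limit//; have [] := cL sl; case: (c s) => q h cl /= -> -> lcl.
  congr (Config _ _); apply: funext => i; apply: funext => n.
  apply/idP/asboolP => [/lcl h1 r /h1[s' [rs' s's v]]|h1].
  + by exists s'; split=> //; rewrite -IH.
  + by apply/lcl => r /h1[s' [rs' s's v]]; exists s'; split=> //; rewrite IH.
Qed.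

Lemma halts_inE (t : a) (q : state (aux_state T)) : halts_in x t q <->
  [/\ forall s, ole s t -> ~ halting (cstate (run s)), cstate (step (run t)) = q & halting q].
Proof.
split=> [[c [ok nh cq hq]]|[nh cq hq]].
  have cr := run_unique ok; split=> // [s st|]; first by rewrite -cr//; exact: nh.
  by rewrite -cr//; right.
by exists run; split=> // s _; exact: run_ok.
Qed.

(** After a halting step the next stage is in a halting state, which rules out any later halting
    step. *)
Lemma halts_in_inj (s t : a) (q r : state (aux_state T)) : halts_in x s q -> halts_in x t r -> s = t /\ q = r.
Proof.
have main (s' t' : a) (q' r' : state (aux_state T)) : halts_in x s' q' -> halts_in x t' r' -> ole t' s'.
  move=> /halts_inE[_ sq hq] /halts_inE[nt _ _].
  case: (oleP t' s') => // st.
  (* In an arbitrary well-order [s'] may have no successor; here [t'] lies above it, and the least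
     element above [s'] is one. *)
  have [u [su ut]] : exists u, is_osucc s' u /\ ole u t'.
    have [[u su]|nu] := pselect (exists u, is_osucc s' u).
      by exists u; split=> //; case: (oleP u t') => // tu; case: (su.2 t').
    elim/(well_founded_ind (@olt_wf a)): t' {nt} st => t' IH st.
    case: nu; apply: contrapT => nu.
    have [[u [su ut]]|h] := pselect (exists u, olt s' u /\ olt u t').
      by have [v [sv _]] := IH u ut su; apply: nu; exists v.
    by apply: nu; exists t'; split=> // u su; apply: h; exists u.
  by case: (nt u ut); rewrite (runS su) sq.
move=> hs ht; have st : s = t.
  case: (main _ _ _ _ hs ht) => // ts; case: (main _ _ _ _ ht hs) => // st.
  by case: (olt_irr (olt_trans st ts)).
by split=> //; move: hs ht; rewrite st => /halts_inE[_ <- _] /halts_inE[_ <- _].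
Qed.

Lemma accepts_rejects : accepts T a x -> rejects T a x -> False.
Proof. by move=> [s hs] [t ht]; have [_] := halts_in_inj hs ht. Qed.

End Run.

(** * Adding a witness tape that is ignored *)

Section IgnoreSecond.
Variables (T : ittm 1) (neg : bool).

(** Exchanging the verdicts lets one construction serve both a set and its complement. *)
Definition flip_state (q : state (aux_state T)) : state (aux_state T) :=
  if neg then match q with Accept => Reject | Reject => Accept | _ => q end else q.

Let old (i : tape 1) : tape 2 :=
  match i with Input _ => Input ord0 | Scratch => Scratch | Output => Output end.

Let ext A (r : tape 1 -> A) (v : A) (i : tape 2) : A :=
  match i with
  | Input i => if i == ord0 then r (Input ord0) else v
  | Scratch => r Scratch
  | Output => r Output
  end.

Let extK A (r : tape 1 -> A) v i : ext r v (old i) = r i.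
Proof. by case: i => // i; rewrite /= (ord1 i). Qed.

Definition ignore_second : ittm 2 :=
  @ITTM 2 (aux_state T) (fun q r =>
    let: (q', w, m) := program q (r \o old) in
    (flip_state q', ext w (r (Input ord_max)), m)).

Variables (a : ordinal_rep) (x y : real).

Let lift (c : config 1 (aux_state T)) : config 2 (aux_state ignore_second) :=
  @Config 2 (aux_state ignore_second) (cstate c) (head c) (ext (cells c) y).

Let ext_init : lift (initial T [tuple x]) = initial ignore_second [tuple x; y].
Proof.
congr (Config _ _); apply: funext => -[[[|[|//]] lti]||] //=; apply: funext => n /=.
Qed.

Let flipE q : ~ halting q -> flip_state q = q.
Proof. by rewrite /flip_state /halting; case: neg q => -[||||q] // []; auto. Qed.

Let halting_flip q : halting (flip_state q) <-> halting q.
Proof. rewrite /flip_state /halting; case: neg q => -[||||q] //=; split; case; auto. Qed.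

Let step_lift c : step (lift c) =
  let d := step c in @Config 2 (aux_state ignore_second) (flip_state (cstate d)) (head d) (ext (cells d) y).
Proof.
rewrite /step /lift /=.
have -> : (fun t => ext (cells c) y t (head c)) \o old = (fun t => cells c t (head c)).
  by apply: funext => i; rewrite /comp extK.
case: program => -[q w] m /=; congr (Config _ _).
apply: funext => -[i||] /=; apply: funext => n //.
by case: (i == ord0) => //; case: eqP => [->|].
Qed.

Lemma ignore_second_halts t q : halts_in [tuple x] t q ->
  @halts_in 2 ignore_second a [tuple x; y] t (flip_state q).
Proof.
move=> [c [ok nh cq hq]]; exists (lift \o c); split=> //=; last 2 first.
- by rewrite step_lift /= cq.
- exact/halting_flip.
move=> s st; have [c0 cS cL] := ok s st; split=> [s0|r rs|sl] /=.
- by rewrite c0.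
- rewrite step_lift (cS r rs) /= flipE //.
  by rewrite -(cS r rs); exact: nh.
- have [-> -> lc] := cL sl; split=> // -[i||] n; rewrite /ext; try exact: lc.
  case: eqP => _; first exact: lc.
  (* The witness tape is constant in time, and equals its [limsup] because some stage precedes a
     limit. *)
  split=> [-> r rs|h]; first by exists r; split=> //; right.
  have [r rs] : exists r, olt r s.
    by apply: contrapT => nr; apply: sl.1 => r rs; apply: nr; exists r.
  by have [s' []] := h r rs.
Qed.

End IgnoreSecond.

Lemma P_NP (a : ordinal_rep) (A : set real) : P_ a A -> NP_ a A /\ coNP_ a A.
Proof.
move=> [T [b [dec hb]]].
have main neg : NP_ a (if neg then ~` A else A).
  exists (ignore_second T neg), b; split=> [x|x y]; last first.
    have [t [q [tb tq]]] := hb x.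
    by exists t, (flip_state neg q); split=> //; exact: ignore_second_halts.
  split=> [Ax|[y acc]].
    exists (fun=> false); case: neg Ax => /= Ax.
    + by have [t /(ignore_second_halts true) ht] := (dec x).2 Ax; exists t; exact: ht.
    + by have [t /(ignore_second_halts false) ht] := (dec x).1 Ax; exists t; exact: ht.
  case: neg acc => acc /=.
  + move=> /(dec x).1[t /(ignore_second_halts true) ht].
    by apply: (accepts_rejects acc); exists t; exact: ht.
  + apply: contrapT => /(dec x).2[t /(ignore_second_halts false) ht].
    by apply: (accepts_rejects acc); exists t; exact: ht.
split; first exact: (main false).
by exists (~` A); [exact: (main true)|rewrite setCK].
Qed.

(** * Kernels and circuits *)

(* Tracks of [x]: 0 and 1 give the ordinal of vertex [d] from that of [d - 1], 2 is the
   sequence of edges, 3 marks vertices; the vertices off track 4 never enter the kernel. *)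
Definition track (r : nat) (z : real) (d : nat) : bool := z (5 * d + r).

Fixpoint onode (x : real) (d : nat) : Om :=
  if d is d'.+1 then
    if track 0 x d then
      if track 1 x d then omul (onode x d') else osuc (onode x d')
    else ozero
  else ozero.

Definition lower (x : real) (m d : nat) : Prop :=
  track 2 x (m + d) /\ olt (onode x m) (onode x d).

Definition kernel (x : real) (b : nat -> bool) : Prop :=
  forall d, b d <-> track 4 x d /\ forall m, lower x m d -> ~ b m.

Lemma onode_ind (x : real) (P : nat -> Prop) :
  (forall d, (forall m, olt (onode x m) (onode x d) -> P m) -> P d) -> forall d, P d.
Proof.
move=> IH d; have [t] : exists t, t = onode x d by exists (onode x d).
elim/(well_founded_ind (@olt_wf Om)): t d => t IHt d td.
by apply: IH => m md; apply: (IHt (onode x m)) => //; rewrite td.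
Qed.

Lemma kernel_unique x b b' : kernel x b -> kernel x b' -> b =1 b'.
Proof.
move=> kb kb'; elim/(@onode_ind x) => d IHd; apply/idP/idP.
- move=> /kb[xd nb]; apply/kb'; split=> // m md; rewrite -IHd; [exact: nb|exact: md.2].
- move=> /kb'[xd nb]; apply/kb; split=> // m md; rewrite IHd; [exact: nb|exact: md.2].
Qed.

Lemma kernel_exists x : exists b, kernel x b.
Proof.
pose R m d := olt (onode x m) (onode x d).
have wfR : well_founded R by move=> d; elim/(@onode_ind x): d; constructor.
pose F d (rec : forall m, R m d -> bool) : bool :=
  `[< track 4 x d /\ forall m (h : R m d), track 2 x (m + d) -> ~ rec m h >].
exists (Fix wfR (fun=> bool) F) => d; rewrite Fix_eq; last first.
  move=> {}d f g fg; suff -> : f = g by [].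
  by do 2![apply: functional_extensionality_dep; move=> ?].
split=> [/asboolP[xd h]|[xd h]]; [|apply/asboolP]; split=> //.
- by move=> m [hm md]; exact: h.
- by move=> m md hm; apply: h.
Qed.

(** Quantifying over all kernels amounts to speaking of the only one, by [diagP]. *)
Definition diag : set real := [set x | forall b, kernel x b -> exists m, track 3 x m /\ b m].

Lemma diagP x b : kernel x b -> diag x <-> exists m, track 3 x m /\ b m.
Proof.
move=> kb; split=> [/(_ b kb)//|h b' kb'].
by have <- : b = b' by apply: funext; exact: kernel_unique kb kb'.
Qed.

(* Circuits of countably branching NOR gates, whose leaves read a bit of the input. *)
Record dag := Dag {
  gate : countType;
  leaf : gate -> option nat;
  wire : gate -> gate -> Prop;
  rank : gate -> Om;
  value : gate -> real -> Prop;
  wire_lt : forall u v, wire u v -> olt (rank v) (rank u);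
  leaf_gt0 : forall u k, leaf u = Some k -> olt ozero (rank u);
  leaf_value : forall u k, leaf u = Some k -> forall x, value u x <-> x k;
  nor_value : forall u, leaf u = None ->
    forall x, value u x <-> forall v, wire u v -> ~ value v x
}.

Definition computable (t : Om) (S : real -> Prop) : Prop :=
  exists (D : dag) (u : gate D), ole (rank u) t /\ forall x, value u x <-> S x.

(** The rank is positive because a leaf will be realised by a vertex that needs room for a vertex of
    rank 0 below it. *)
Lemma computable_bit t k : olt ozero t -> computable t (fun x => x k).
Proof.
move=> t0; pose D := @Dag unit (fun=> Some k) (fun _ _ => False) (fun=> t) (fun _ x => x k).
unshelve eexists (D _ _ _ _), tt => //=; by [move=> _ k' [<-]|split=> //; right].
Qed.

(** The circuits of the [S i] are put side by side, and [None] is a new gate on top, wired to their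
    output gates. *)
Lemma computable_nor (I : countType) (P : I -> Prop) (S : I -> real -> Prop) t :
  (forall i, P i -> exists2 s, olt s t & computable s (S i)) ->
  computable t (fun x => forall i, P i -> ~ S i x).
Proof.
move=> hS.
have /choice[G GP] (i : I) : exists p : {D : dag & gate D}, P i ->
    olt (rank (projT2 p)) t /\ forall x, value (projT2 p) x <-> S i x.
  have [/hS[s st [D [u [us uS]]]]|nP] := pselect (P i).
    by exists (existT _ D u) => _; split=> //=; exact: ole_olt_trans st.
  (* A dummy circuit for the indices outside [P], which is not wired to the top gate. *)
  have [D [u _]] := computable_bit 0 (osuc_gt0 ozero).
  by exists (existT _ D u).
pose D i := projT1 (G i).
pose V : countType := option {i : I & gate (D i)}.
pose lf (u : V) := if u is Some (existT i v) then leaf v else None.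
pose ar (u u' : V) := match u, u' with
  | None, Some u' => exists i, P i /\ u' = existT _ i (projT2 (G i))
  | Some (existT i v), Some u' => exists v' : gate (D i), u' = existT _ i v' /\ wire v v'
  | _, _ => False
  end.
pose rk' (u : V) := if u is Some (existT i v) then rank v else t.
pose vl (u : V) x := if u is Some (existT i v) then value v x else forall i, P i -> ~ S i x.
unshelve eexists (@Dag V lf ar rk' vl _ _ _ _), None.
- move=> [[i v]|] [u'|] //=; first by move=> [v' [-> ]]; exact: wire_lt.
  by move=> [i [Pi ->]]; exact: (GP i Pi).1.
- by move=> [[i v]|] //=; exact: leaf_gt0.
- by move=> [[i v]|] //=; exact: leaf_value.
- move=> [[i v]|] /= lv x.
    rewrite nor_value//; split=> h.
    + by move=> [u'|] //= [v'' [-> vv'']]; exact: h.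
    + by move=> v' vv'; apply: (h (Some (existT _ i v'))) => /=; exists v'.
  split=> h.
  + by move=> [u'|] //= [i [Pi ->]] /(GP i Pi).2; exact: h.
  + move=> i Pi /(GP i Pi).2 Si.
    by apply: (h (Some (existT _ i (projT2 (G i))))) => //=; exists i.
- by split=> //; right.
Qed.

(** * Coding a circuit as a graph *)

Lemma solve_bits (e : nat -> bool + nat) : (forall n k, e n = inr k -> k < n) ->
  exists x : real, forall n, x n = match e n with inl v => v | inr k => ~~ x k end.
Proof.
(* [g] is fuel; every value above [n] yields the same bit, as [fE] shows. *)
move=> elt; pose fix f (g n : nat) {struct g} : bool := if g is g'.+1 then
  match e n with inl v => v | inr k => ~~ f g' k end else false.
have fE g n : n < g -> f g n = f n.+1 n.
  elim/ltn_ind: n g => n IHn [//|g] ng /=.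
  case en: (e n) => [//|k]; have kn := elt n k en.
  by rewrite (IHn k kn g) ?(IHn k kn n) //; lia.
exists (fun n => f n.+1 n) => n /=; case en: (e n) => [//|k].
by rewrite fE//; exact: elt en.
Qed.

Fixpoint horner (l : seq bool) : Om :=
  if l is o :: l' then (if o then omul else osuc) (horner l') else ozero.

Lemma horner_surj t : exists l, t = horner l.
Proof.
have [s ->] := oval_surj t; elim: s => [|n s [l lE]]; first by exists [::].
exists (nseq n false ++ true :: l); rewrite /= /rk lE.
by elim: n => //= n ->.
Qed.

(** The word is stored backwards: a reset to [ozero] at [d], then the letters from last to first,
    with the outermost operation at [d + size l]. *)
Lemma onode_horner x d l : track 0 x d = false \/ d = 0 ->
  (forall j, j < size l -> track 0 x (d + size l - j) /\
     track 1 x (d + size l - j) = nth false l j) ->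
  onode x (d + size l) = horner l.
Proof.
move=> xd; elim: l => [|o l IHl] xl.
  by rewrite addn0; case: d xd {xl} => //= d [->|].
rewrite /= addnS /=; have [] := xl 0 isT; rewrite subn0 /= addnS => -> ->.
rewrite IHl; first by case: o {xl}.
by move=> j jl; have := xl j.+1 jl; rewrite /= addnS subSS.
Qed.

(* The [len i] cells before [pos i] are left to spell out the ordinal of vertex [pos i]. *)
Lemma sparse_positions (len low : nat -> nat) : exists pos : nat -> nat,
  [/\ forall i, len i <= pos i, forall i, low i <= pos i,
      forall i j, i < j -> pos i + len j < pos j
    & forall i j i' j', i < j -> i' < j' -> pos i + pos j = pos i' + pos j' -> i = i' /\ j = j'].
Proof.
(* Each position exceeds twice the previous one, so a sum of two distinct positions determines the
   larger one and then the smaller. *)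
pose pos := fix f i := if i is i'.+1 then (2 * f i' + len i + low i).+1 else len 0 + low 0.
have posS i : pos i.+1 = (2 * pos i + len i.+1 + low i.+1).+1 by [].
have gap i j : i < j -> 2 * pos i + len j < pos j.
  elim: j => // j IHj; rewrite ltnS leq_eqVlt => /orP[/eqP->|/IHj]; rewrite posS; lia.
have mono i j : pos i < pos j -> i < j.
  by move=> ij; case: (ltngtP i j) => [//|/gap|ji]; [lia|rewrite ji in ij; lia].
exists pos; split.
- by case=> [|i]; rewrite ?posS; [rewrite leq_addr|lia].
- by case=> [|i]; rewrite ?posS; [rewrite leq_addl|lia].
- by move=> i j /gap; lia.
move=> i j i' j' ij ij' eqs.
have jj' : j = j'.
  have := gap _ _ ij; have := gap _ _ ij'.
  by case: (ltngtP j j') => // /gap; lia.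
split=> //; rewrite jj' in eqs.
case: (ltngtP i i') => // /gap; lia.
Qed.

Lemma glue (A : Type) (x0 : A) (I : nat -> nat -> Prop) (f : nat -> nat -> A) :
  (forall i j d, I i d -> I j d -> i = j) ->
  exists c : nat -> A, forall i d, I i d -> c d = f i d.
Proof.
move=> Iinj; exists (fun d => if pselect (exists i, I i d) is left e then f (projT1 (cid e)) d else x0).
move=> i d id; case: pselect => [e|[]]; last by exists i.
by case: cid => j /= jd; rewrite (Iinj _ _ _ jd id).
Qed.

(** The circuit is planted in the graph: gates become vertices with their ranks as ordinals, wires
    become edges, and only the root is marked. Membership in the kernel then computes the NOR
    values. *)
Lemma diag_complete t S : computable t S -> exists x, diag x <-> S x.
Proof.
move=> [D [root [_ rootS]]].
pose W : countType := option (gate D).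
pose rkW (w : W) := if w is Some u then rank u else ozero.
pose rr i := if (unpickle i : option W) is Some w then rkW w else ozero.
have /choice[word wordE] i : exists l, rr i = horner l by exact: horner_surj.
(* A leaf reading bit [k] sits at a position at least [k], so that the bits coding its edges come
   after bit [k] of [x]. *)
pose low i := if (unpickle i : option W) is Some (Some u) then odflt 0 (@leaf D u) else 0.
have [pos [pos_len pos_low pos_lt pos_sum]] := sparse_positions (fun i => size (word i)) low.
have pos_inj i j : pos i = pos j -> i = j.
  by move=> ij; case: (ltngtP i j) => // /pos_lt; lia.
pose I i d := pos i - size (word i) <= d <= pos i.
have Iinj i j d : I i d -> I j d -> i = j.
  rewrite /I => id jd; case: (ltngtP i j) => // ij.
  - by have := pos_lt _ _ ij; have := pos_len j; lia.
  - by have := pos_lt _ _ ij; have := pos_len i; lia.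
(* The first cell of each interval gets [false] on track 0, which resets the ordinal to zero
   there. *)
have [c cE] := glue (false, false) (fun i d => (d != pos i - size (word i), nth false (word i) (pos i - d))) Iinj.
pose P (w : W) := pos (pickle w).
have Pinj v w : P v = P w -> v = w.
  by move=> /pos_inj; exact: (pcan_inj pickleK).
have rrE w : rr (pickle w) = rkW w by rewrite /rr pickleK.
(* The bit [k] of [x] is the value of a vertex whose only possible lower neighbour is the
   vertex [None], of rank 0 and hence in the kernel; the edge is present iff [x k] fails. *)
pose edge (v w : W) : bool + nat := match v, w with
  | None, Some u | Some u, None => if leaf u is Some k then inr k else inl false
  | Some u, Some u' => inl `[< leaf u = None /\ wire u u' \/ leaf u' = None /\ wire u' u >]
  | None, None => inl false
  end.
have edgeC v w : edge v w = edge w v.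
  by case: v w => [u|] [u'|] //=; congr inl; apply: asbool_equiv_eq; tauto.
(* An edge bit is indexed by a sum of positions. By [pos_sum] this sum determines the unordered
   pair, and [edge] is symmetric. *)
have [h hE] : exists h : nat -> bool + nat,
    (forall v w, v <> w -> h (P v + P w) = edge v w) /\
    (forall e k, h e = inr k -> k <= e).
  pose J (p : W * W) e := p.1 <> p.2 /\ P p.1 + P p.2 = e.
  exists (fun e => if pselect (exists p, J p e) is left ex then
    edge (projT1 (cid ex)).1 (projT1 (cid ex)).2 else inl false); split.
    move=> v w vw; case: pselect => [ex|[]]; last by exists (v, w).
    case: cid => -[v' w'] [/= vw' s].
    have pk (u u' : W) : u <> u' -> pickle u < pickle u' \/ pickle u' < pickle u.
      move=> uu'; case: (ltngtP (@pickle W u) (pickle u')); [by left|by right|].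
      by move/(pcan_inj pickleK).
    have pkI (u u' : W) : pickle u = pickle u' -> u = u' by exact: (pcan_inj pickleK).
    rewrite /P in s.
    case: (pk _ _ vw) => l1; case: (pk _ _ vw') => l2.
    - by have [/pkI-> /pkI->] := pos_sum _ _ _ _ l2 l1 s.
    - rewrite addnC in s.
      by have [/pkI-> /pkI->] := pos_sum _ _ _ _ l2 l1 s.
    - rewrite [RHS]addnC in s.
      by have [/pkI-> /pkI->] := pos_sum _ _ _ _ l2 l1 s.
    - rewrite addnC [RHS]addnC in s.
      by have [/pkI-> /pkI->] := pos_sum _ _ _ _ l2 l1 s.
  move=> e k; case: pselect => // ex; case: cid => -[v w] [/= vw <-].
  have pl u j : leaf u = Some j -> j <= P (Some u).
    by move=> uj; have := pos_low (pickle (Some u : W)); rewrite /low pickleK uj.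
  case: v w {vw} => [u|] [u'|] //=.
  - by case lu: (leaf u) => [j|] // -[<-]; have := pl _ _ lu; lia.
  - by case lu: (leaf u') => [j|] // -[<-]; have := pl _ _ lu; lia.
case: hE => hE hk.
pose act d := `[< exists w, d = P w >].
pose e n := let d := n %/ 5 in
  if n %% 5 == 0 then inl (c d).1 else if n %% 5 == 1 then inl (c d).2
  else if n %% 5 == 2 then h d else if n %% 5 == 3 then inl (d == P (Some root)) else inl (act d).
(* The edges at leaves refer to earlier bits of [x] itself; this fixed point provides the
   self-reference of the diagonal argument. *)
have [x xE] : exists x : real, forall n, x n = match e n with inl v => v | inr k => ~~ x k end.
  apply: solve_bits => n k; rewrite /e.
  by case: eqP => // _; case: eqP => // _; case: eqP => [n2 /hk|_]; [lia|case: eqP].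
have xr r d : r < 5 -> track r x d = match e (5 * d + r) with inl v => v | inr k => ~~ x k end.
  by move=> _; rewrite /track xE.
have dv r d : r < 5 -> (5 * d + r) %/ 5 = d by lia.
have md r d : r < 5 -> (5 * d + r) %% 5 = r by lia.
have x0 d : track 0 x d = (c d).1 by rewrite xr// /e dv// md.
have x1 d : track 1 x d = (c d).2 by rewrite xr// /e dv// md.
have x2 d : track 2 x d = match h d with inl v => v | inr k => ~~ x k end.
  by rewrite xr// /e dv// md.
have x3 d : track 3 x d = (d == P (Some root)) by rewrite xr// /e dv// md.
have x4 d : track 4 x d = act d by rewrite xr// /e dv// md.
have oP w : onode x (P w) = rkW w.
  rewrite -rrE wordE /P; set i := pickle w.
  rewrite -{1}(subnK (pos_len i)); apply: onode_horner.
    by left; rewrite x0 (cE i) /= ?eqxx // /I; have := pos_len i; lia.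
  move=> j jl; rewrite x0 x1 (subnK (pos_len i)) (cE i) /=.
    by split; [|congr nth]; have := pos_len i; lia.
  by rewrite /I; have := pos_len i; lia.
pose vW (w : W) := if w is Some u then value u x else True.
pose b d := `[< exists w, d = P w /\ vW w >].
have bP w : b (P w) <-> vW w.
  by split=> [/asboolP[w' [/Pinj<-]]//|vw]; apply/asboolP; exists w.
(* By uniqueness it suffices that the gate values, with [None] counted as true, satisfy the kernel
   equations. *)
have kb : kernel x b.
  move=> d; split.
    move=> /asboolP[w [-> vw]]; split; first by rewrite x4; apply/asboolP; exists w.
    move=> m [xm om] /asboolP[w' [mE vw']]; subst m.
    have ww' : w' <> w by move=> ww'; rewrite ww' in om; exact: olt_irr om.
    move: xm; rewrite x2 hE // ; rewrite !oP in om.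
    case: w w' vw vw' om {ww'} => [u|] [u'|] //=.
    - move=> uv u'v ltu /asboolP[[_ /wire_lt]|[lu uu']].
      + by move=> /olt_trans/(_ ltu)/olt_irr.
      + by move: uv; rewrite nor_value// => /(_ _ uu').
    - move=> uv _ _; case lu: (leaf u) => [k|//]; move: uv; rewrite (leaf_value lu).
      by move=> ->.
    - by move=> _ _ /olt0.
  rewrite x4 => -[/asboolP[w ->] nl]; apply/bP.
  have lowE w' : w' <> w -> olt (rkW w') (rkW w) ->
      match edge w' w with inl v => v | inr k => ~~ x k end -> ~ vW w'.
    move=> ww' lt e' /bP; apply: nl; split; last by rewrite !oP.
    by rewrite x2 hE.
  case: w {nl} lowE => [u|//] lowE /=.
  case lu: (leaf u) => [k|].
    rewrite (leaf_value lu); apply: contrapT => /negP nk.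
    by apply: (lowE None) => //=; [exact: leaf_gt0 lu|rewrite lu].
  rewrite nor_value// => u' uu'; have ltu := wire_lt uu'.
  apply: (lowE (Some u')) => //=.
    by move=> -[E]; rewrite E in ltu; exact: olt_irr ltu.
  by apply/asboolP; right.
exists x; rewrite (diagP kb) -rootS; split=> [[m []]|vr].
- by rewrite x3 => /eqP -> /bP.
- by exists (P (Some root)); split; [rewrite x3|apply/bP].
Qed.

(** * Circuits for computations *)

Section Computable.
Variable t : Om.

Lemma computable_le s u S : ole s u -> computable s S -> computable u S.
Proof. by move=> su [D [v [vs vS]]]; exists D, v; split=> //; exact: ole_trans su. Qed.

Lemma computable_ext u S S' : (forall x, S x <-> S' x) -> computable u S -> computable u S'.
Proof. by move=> SS' [D [v [vu vS]]]; exists D, v; split=> // x; rewrite vS. Qed.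

Lemma computable_leq j k S : j <= k -> computable (rk t j) S -> computable (rk t k) S.
Proof. by move=> jk; apply: computable_le; apply/rk_le; right. Qed.

Let lt_rkS k : olt (rk t k) (rk t k.+1).
Proof. by apply/rk_lt; right. Qed.

Lemma computable_not k S : computable (rk t k) S -> computable (rk t k.+1) (fun x => ~ S x).
Proof.
move=> kS.
apply: (computable_ext _ (@computable_nor unit (fun=> True) (fun=> S) _ _)) => [x|[] _].
  by split=> [/(_ tt)|]; tauto.
by exists (rk t k).
Qed.

(** A NOR gate without inputs. *)
Lemma computable_true u : computable u (fun=> True).
Proof.
by apply: (computable_ext _ (@computable_nor unit (fun=> False) (fun _ _ => True) _ _)).
Qed.

Lemma computable_const k (Q : Prop) : computable (rk t k.+1) (fun=> Q).
Proof.
have [q|nq] := pselect Q.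
  by apply: computable_ext (computable_true _) => x; tauto.
by apply: computable_ext (computable_not (computable_true (rk t k))) => x; tauto.
Qed.

Lemma computable_all (I : countType) (Q : I -> Prop) S k :
  (forall i, Q i -> computable (rk t k) (S i)) ->
  computable (rk t k.+2) (fun x => forall i, Q i -> S i x).
Proof.
move=> kS.
apply: (computable_ext _ (@computable_nor I Q (fun i x => ~ S i x) _ _)) => [x|i Qi].
  by split=> h i /h; [exact: contrapT|move=> Si; apply].
by exists (rk t k.+1) => //; apply: computable_not; exact: kS.
Qed.

Lemma computable_ex (I : countType) (Q : I -> Prop) S k :
  (forall i, Q i -> computable (rk t k) (S i)) ->
  computable (rk t k.+2) (fun x => exists i, Q i /\ S i x).
Proof.
move=> kS.
apply: (computable_ext _ (computable_not (@computable_nor I Q S _ _))) => [x|i Qi].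
  split=> [nS|[i [Qi Si]] /(_ i Qi)//].
  by apply: contrapT => nex; apply: nS => i Qi Si; apply: nex; exists i.
by exists (rk t k) => //; exact: kS.
Qed.

Lemma computable_and k S S' : computable (rk t k) S -> computable (rk t k) S' ->
  computable (rk t k.+2) (fun x => S x /\ S' x).
Proof.
move=> kS kS'; apply: (computable_ext _
  (@computable_all bool (fun=> True) (fun i => if i then S else S') k _)) => [x|[]//].
split=> [h|[Sx S'x] []//].
by split; [exact: (h true)|exact: (h false)].
Qed.

Lemma computable_or k S S' : computable (rk t k) S -> computable (rk t k) S' ->
  computable (rk t k.+2) (fun x => S x \/ S' x).
Proof.
move=> kS kS'; apply: (computable_ext _
  (@computable_ex bool (fun=> True) (fun i => if i then S else S') k _)) => [x|[]//].
split=> [[[] []]|[Sx|S'x]]; [by left|by right|by exists true|by exists false].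
Qed.

End Computable.

Section RunBits.
Variable T : ittm 1.
Local Notation Q := (state (aux_state T)).
Local Notation runx t x := (@run 1 T Om [tuple x] t).

Definition stage_computable (t r : Om) : Prop :=
  [/\ forall q : Q, computable r (fun x => cstate (runx t x) = q),
      forall p, computable r (fun x => head (runx t x) = p)
    & forall i n, computable r (fun x => cells (runx t x) i n = true)].

Lemma stage_computable_le t r r' : ole r r' -> stage_computable t r -> stage_computable t r'.
Proof.
move=> rr' [h1 h2 h3]; split=> *; by [apply: computable_le (h1 _)|
  apply: computable_le (h2 _)|apply: computable_le (h3 _ _)].
Qed.

(** What a step depends on: the state, the head position and the three scanned symbols. Nested
    options encode the special states, which keeps the type countable. *)
Let code : countType := ((option (option (option (option (aux_state T))))) * nat * (bool * bool * bool))%type.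
Let dst (c : code) : Q := match c.1.1 with
  | None => Start | Some None => Limit | Some (Some None) => Accept
  | Some (Some (Some None)) => Reject | Some (Some (Some (Some q))) => Aux q end.
Let dsym (c : code) (i : tape 1) : bool :=
  match i with Input _ => c.2.1.1 | Scratch => c.2.1.2 | Output => c.2.2 end.
Let view (c : code) (d : config 1 (aux_state T)) : Prop :=
  (cstate d = dst c /\ head d = c.1.2) /\
  (cells d (Input ord0) c.1.2 = dsym c (Input ord0) /\
   (cells d Scratch c.1.2 = dsym c Scratch /\ cells d Output c.1.2 = dsym c Output)).

Let view_ex d : exists c, view c d.
Proof.
pose p := head d; pose w i := cells d i p.
pose qc : option (option (option (option (aux_state T)))) := match cstate d with
  | Start => None | Limit => Some None | Accept => Some (Some None)
  | Reject => Some (Some (Some None)) | Aux q => Some (Some (Some (Some q))) end.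
exists (qc, p, (w (Input ord0), w Scratch, w Output)).
by rewrite /view /dst /dsym /qc /=; case: (cstate d).
Qed.

Let view_step c d : view c d ->
  step d = let: (q, w, m) := program (dst c) (dsym c) in
    Config q (match m with MoveLeft => c.1.2.-1 | MoveRight => c.1.2.+1 end)
      (fun t n => if n == c.1.2 then w t else cells d t n).
Proof.
move=> [[st hd] [h1 [h2 h3]]]; rewrite /step st hd.
have -> : (fun t => cells d t c.1.2) = dsym c; last by [].
by apply: funext => -[i||] //; rewrite (ord1 i).
Qed.

(** A negated bit costs one layer and each conjunction two: the cells rise from 4 to 5, then the
    nested conjunctions to 7, 9 and 11. *)
Let view_computable t c : stage_computable t (rk t 4) ->
  computable (rk t 11) (fun x => view c (runx t x)).
Proof.
move=> [h1 h2 h3]; have h3' i n v : computable (rk t 5) (fun x => cells (runx t x) i n = v).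
  case: v; first exact: computable_leq (h3 i n).
  apply: computable_ext (computable_not (h3 i n)) => x.
  by case: cells.
apply: computable_and; first by apply: (@computable_leq t 6) => //; exact: computable_and.
by apply: computable_and; [exact: (@computable_leq t 5)|exact: computable_and].
Qed.

(** The next stage is a disjunction over all local views. The constant 15 is harmless, as
    [omega * t + 15] is below [omega * (t + 1)]. *)
Let stage_computable_succ t : stage_computable t (rk t 4) ->
  stage_computable (osuc t) (rk t 15).
Proof.
move=> ht; have vt := view_computable _ ht; have [_ _ h3] := ht.
pose nxt (c : code) := program (dst c) (dsym c).
have main (R : code -> Prop) (S : real -> Prop) :
    (forall c x, view c (runx t x) -> (R c <-> S x)) -> computable (rk t 15) S.
  move=> RS; apply: (@computable_leq t 13) => //.
  apply: computable_ext (@computable_ex t code R (fun c x => view c (runx t x)) 11 (fun c _ => vt c)) => x.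
  split=> [[c [Rc /RS]]|Sx]; first by move=> <-.
  by have [c vc] := view_ex (runx t x); exists c; split=> //; apply/(RS _ _ vc).
split=> [q|p|i n].
- apply: (main (fun c => (nxt c).1.1 = q)) => c x vc.
  by rewrite (runS _ _ (osuc_is_osucc t)) (view_step vc) /nxt; case: program => -[].
- apply: (main (fun c => match (nxt c).2 with MoveLeft => c.1.2.-1 | MoveRight => c.1.2.+1 end = p)) => c x vc.
  by rewrite (runS _ _ (osuc_is_osucc t)) (view_step vc) /nxt; case: program => -[].
have sE c x : view c (runx t x) -> (cells (runx (osuc t) x) i n = true <->
    (if n == c.1.2 then (nxt c).1.2 i = true else cells (runx t x) i n = true)).
  move=> vc; rewrite (runS _ _ (osuc_is_osucc t)) (view_step vc) /nxt; case: program => -[q w] m /=.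
  by case: ifP.
apply: computable_ext (@computable_ex t code (fun=> True) (fun c x => view c (runx t x) /\
  (if n == c.1.2 then (nxt c).1.2 i = true else cells (runx t x) i n = true)) 13 _).
- move=> x; split=> [[c [_ [vc]]]|h]; first by move/(sE _ _ vc).
  by have [c vc] := view_ex (runx t x); exists c; split=> //; split=> //; apply/sE.
- move=> c _; apply: computable_and; first exact: vt.
  case: (n == c.1.2); first exact: computable_const.
  exact: (@computable_leq t 4).
Qed.

(** The 4 comes from limits: the [limsup] is two quantifiers, of two layers each, over bits of rank
    below [omega * t]. *)
Lemma run_computable t : stage_computable t (rk t 4).
Proof.
elim/(well_founded_ind (@olt_wf Om)): t => t IHt.
case: (stage_cases t) => [t0|[s st]|tl].
- split=> [q|p|i n].
  + by apply: computable_ext (@computable_const t 3 (Start = q)) => x; rewrite run0.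
  + by apply: computable_ext (@computable_const t 3 (0 = p)) => x; rewrite run0.
  + case: i => [i||].
    * apply: computable_ext (@computable_bit (rk t 4) n _) => [x|].
        by rewrite run0 //= (ord1 i).
      exact: osuc_gt0.
    * by apply: computable_ext (@computable_const t 3 False) => x; rewrite run0.
    * by apply: computable_ext (@computable_const t 3 False) => x; rewrite run0.
- rewrite (is_osucc_eq st); apply: stage_computable_le (stage_computable_succ (IHt _ st.1)).
  by apply/rk_le; left; exact: (osuc_is_osucc s).1.
- split=> [q|p|i n].
  + by apply: computable_ext (@computable_const t 3 (Limit = q)) => x; rewrite run_limit.
  + by apply: computable_ext (@computable_const t 3 (0 = p)) => x; rewrite run_limit.
  + apply: computable_ext (@computable_all t (seq nat) (fun l => olt (oval l) t)
      (fun l x => exists l' : seq nat, (ole (oval l) (oval l') /\ olt (oval l') t) /\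
        cells (runx (oval l') x) i n = true) 2 _).
      move=> x; rewrite run_limit //=; split=> [h|/asboolP h l /h].
        apply/asboolP => r; have [l ->] := oval_surj r => /h[l' [[h1 h2] h3]].
        by exists (oval l').
      by move=> [s [h1 h2 h3]]; have [l' sl'] := oval_surj s; exists l'; rewrite -sl'.
    move=> l _; apply: computable_ex => l' [_ l't].
    have [_ _ h3] := IHt _ l't; apply: computable_le (h3 i n).
    by apply/rk_le; left.
Qed.

(** Bounding the accepting stage by [b] keeps the rank of the circuit below [omega ^ omega]. *)
Lemma rejecting_computable (b : Om) : exists r, computable r (fun x =>
  ~ exists t, olt t b /\ @halts_in 1 T Om [tuple x] t Accept).
Proof.
have bits t : ole t b -> stage_computable t (rk b 4).
  by move=> tb; apply: stage_computable_le (run_computable t); apply/rk_le; case: tb; auto.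
pose running x t := forall l : seq nat, ole (oval l) t ->
  ~ (cstate (runx (oval l) x) = Accept \/ cstate (runx (oval l) x) = Reject).
exists (rk b 14); apply: computable_not.
apply: (@computable_leq b 13) => //.
apply: computable_ext (@computable_ex b (seq nat) (fun l => olt (oval l) b)
  (fun l x => running x (oval l) /\ cstate (runx (osuc (oval l)) x) = Accept) 11 _).
  move=> x; split.
    move=> [l [lb [hr ha]]]; exists (oval l); split=> //; apply/halts_inE; split; last by left.
      by move=> s; have [l' ->] := oval_surj s; exact: hr.
    by rewrite -(runS _ _ (osuc_is_osucc _)).
  move=> [t [tb /halts_inE[hr ha _]]]; have [l tl] := oval_surj t.
  exists l; rewrite -tl; split=> //; split; first by move=> l'; exact: hr.
  by rewrite (runS _ _ (osuc_is_osucc _)).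
have sl l : olt (oval l) b -> ole (osuc (oval l)) b.
  by move=> lb; apply/(olt_osuc _ b); apply/osuc_lt.
move=> l lb; apply: computable_and; last first.
  by apply: (@computable_leq b 4) => //; have [h _ _] := bits _ (sl _ lb); exact: h.
apply: computable_all => l' l'l.
have [h _ _] := bits _ (or_introl (ole_olt_trans l'l lb)).
by apply: computable_not; exact: computable_or.
Qed.

End RunBits.

Lemma diag_notin_P : ~ P diag.
Proof.
move=> [T [b [dec hb]]].
(* For this [x], [diag x] holds iff [T] does not accept [x] before stage [b], so either answer of
   [T] is wrong. *)
have [r /diag_complete[x xE]] := rejecting_computable T b.
have [xd|nxd] := pselect (diag x).
- have [t ht] := (dec x).1 xd; apply: (xE.1 xd); exists t; split=> //.
  by have [t' [q [tb ht']]] := hb x; have [-> _] := halts_in_inj ht ht'.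
- have rej := (dec x).2 nxd; apply: nxd; apply/xE => -[t [_ ht]].
  by apply: (accepts_rejects _ rej); exists t.
Qed.

(** * Sweeping machines *)

(* A right-moving transducer on blocks of five cells, which sees the current block
    and the next one and rewrites the current one; every sweep restarts it at the
    leftmost block in state [tr_init]. *)
Record transducer (k : nat) := Transducer {
  tr_state : finType;
  tr_init : tr_state;
  tr_next : tr_state -> (nat -> tape k -> bool) -> tr_state;
  tr_out : tr_state -> (nat -> tape k -> bool) -> nat -> tape k -> bool;
  tr_halt : tr_state -> (nat -> tape k -> bool) -> option bool
}.

Section Sweep.
Variables (k : nat) (M : transducer k).

Let tcode (t : tape k) : option (option 'I_k) :=
  match t with Input i => Some (Some i) | Scratch => Some None | Output => None end.
Let tdecode (c : option (option 'I_k)) : tape k :=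
  match c with Some (Some i) => Input i | Some None => Scratch | None => Output end.
Let tcodeK t : tdecode (tcode t) = t. Proof. by case: t. Qed.

Local Notation buffer := {ffun 'I_10 * option (option 'I_k) -> bool}.

Let contents (b : buffer) (i : nat) (t : tape k) : bool := (i < 10) && b (inord i, tcode t).
Let store (b : buffer) (j : nat) (r : tape k -> bool) : buffer :=
  [ffun p : 'I_10 * option (option 'I_k) => if nat_of_ord p.1 == j then r (tdecode p.2) else b p].

Let contents_store b j r i t : j < 10 ->
  contents (store b j r) i t = if i == j then r t else contents b i t.
Proof.
move=> j10; rewrite /contents /store; case: ltnP => [i10|i10] /=.
  by rewrite ffunE /= inordK// tcodeK.
by case: eqP => // ij; rewrite ij leqNgt j10 in i10.
Qed.

Local Notation control := ('I_25 * buffer * tr_state M)%type.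

Definition verdict (Q : Type) (v : bool) : state Q := if v then Accept else Reject.

(* Steps 0-9 of a block read ten cells rightwards, steps 10-19 go back, and steps
    20-24 write the block. *)
Let work_program (c : control) (r : tape k -> bool) : state control * (tape k -> bool) * move :=
  let: (j, b, s) := c in
  if j < 10 then (Aux (inord j.+1, store b j r, s), r, MoveRight)
  else if j < 20 then
    (match (if nat_of_ord j == 10 then tr_halt s (contents b) else None) with
     | Some v => verdict _ v
     | None => Aux (inord j.+1, b, s)
     end, r, MoveLeft)
  else (Aux (if nat_of_ord j == 24 then (ord0, b, tr_next s (contents b)) else (inord j.+1, b, s)),
        tr_out s (contents b) (j - 20), MoveRight).

Definition sweeper : ittm k := @ITTM k control (fun q =>
  work_program (if q is Aux c then c else (ord0, [ffun=> false], tr_init M))).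

Local Notation conf := (config k (aux_state sweeper)).

Implicit Types (C : tape k -> nat -> bool).

Definition window C (d i : nat) (t : tape k) : bool := (i < 10) && C t (5 * d + i).

Fixpoint sweep_state C (d : nat) : tr_state M :=
  if d is d'.+1 then tr_next (sweep_state C d') (window C d') else tr_init M.

Definition swept C (t : tape k) (n : nat) : bool :=
  tr_out (sweep_state C (n %/ 5)) (window C (n %/ 5)) (n %% 5) t.

Let mixed C (p : nat) (t : tape k) (n : nat) : bool := if n < p then swept C t n else C t n.

(** Cells from the current block on are still old, so every block is treated according to the
    contents before the sweep. *)
Let window_mixed C d : window (mixed C (5 * d)) d = window C d.
Proof.
apply: funext => i; apply: funext => t; rewrite /window /mixed.
by rewrite (ltnNge (_ + _)) leq_addr.
Qed.

Let at_control (c : conf) (j : nat) (s : tr_state M) (b : buffer) : Prop :=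
  cstate c = Aux (inord j, b, s) \/
  j = 0 /\ (cstate c = Start \/ cstate c = Limit) /\ s = tr_init M.

Let at_controlN c j s b : at_control c j s b -> ~ halting (cstate c).
Proof. by rewrite /halting => -[->|[_ [[->|->] _]]] []. Qed.

(** The invariant before step [j] in block [d]; the buffer is claimed to be right only on the cells
    already read. *)
Let mid C (d j : nat) (c : conf) : Prop := exists b,
  [/\ at_control c j (sweep_state C d) b,
      head c = (if j <= 10 then 5 * d + j else if j <= 20 then 5 * d + 20 - j else 5 * d + (j - 20)),
      cells c = mixed C (5 * d + (j - 20))
    & forall i t, i < minn j 10 -> contents b i t = window C d i t].

Let contents_window C d b : (forall i t, i < 10 -> contents b i t = window C d i t) ->
  contents b = window C d.
Proof.
move=> h; apply: funext => i; apply: funext => t.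
by case: (ltnP i 10) => [/h->//|i10]; rewrite /contents /window ltnNge i10.
Qed.

(** In [Start] and [Limit] the buffer is the empty one instead of [b]; this can happen only at step
    0, before anything is read. *)
Let step_control (c : conf) j s b : j < 25 -> at_control c j s b -> exists b',
  (0 < j -> b' = b) /\
  step c = let: (q, w, m) := work_program (inord j, b', s) (fun t => cells c t (head c)) in
    Config (q : state (aux_state sweeper)) (match m with MoveLeft => (head c).-1 | MoveRight => (head c).+1 end)
      (fun t n => if n == head c then w t else cells c t n).
Proof.
move=> j25 [cj|[j0 [cj ->]]].
  by exists b; split=> //; rewrite /step cj /=.
exists [ffun=> false]; split; first by rewrite j0.
have -> : inord j = ord0 :> 'I_25 by apply: val_inj; rewrite /= inordK// j0.
by rewrite /step; case: cj => ->.
Qed.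

Let same_cells (c : conf) :
  (fun t n => if n == head c then cells c t (head c) else cells c t n) = cells c.
Proof. by apply: funext => t; apply: funext => n; case: eqP => // ->. Qed.

Let mid_step C d j c : j < 24 -> (j = 10 -> tr_halt (sweep_state C d) (window C d) = None) ->
  mid C d j c -> mid C d j.+1 (step c).
Proof.
move=> j24 nh [b [cj hd cl bw]].
have [b' [b'b ->]] := step_control (ltnW (j24 : j < 24)) cj.
rewrite /work_program inordK; last by lia.
case: (ltnP j 10) => j10.
  exists (store b' j (fun t => cells c t (head c))); split => /=.
  - by left.
  - by rewrite hd (ltnW j10) j10; lia.
  - by rewrite same_cells cl; congr mixed; lia.
  - move=> i t ij; rewrite contents_store//; case: eqP => [->|nij].
      rewrite hd (ltnW j10) cl (_ : j - 20 = 0) ?addn0; last by lia.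
      by rewrite -window_mixed /window j10.
    have j0 : 0 < j by lia.
    by rewrite b'b// bw//; lia.
have {}b'b : b' = b by apply: b'b; lia.
subst b'.
have bwE : contents b = window C d by apply: contents_window => i t i10; apply: bw; lia.
case: (ltnP j 20) => j20.
  have -> : (if j == 10 then tr_halt (sweep_state C d) (contents b) else None) = None.
    by case: eqP => // /nh; rewrite bwE.
  exists b; split => /=.
  - by left.
  - by rewrite hd j20 ltnNge j10 /=; case: (leqP j 10) => ?; [|rewrite (ltnW j20)]; lia.
  - by rewrite same_cells cl; congr mixed; lia.
  - by move=> i t ij; apply: bw; lia.
rewrite (_ : j == 24 = false); last by lia.
have hdj : head c = 5 * d + (j - 20) by rewrite hd; case: (leqP j 10) => ?; [|case: (leqP j 20) => ?]; lia.
exists b; split => /=.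
- by left.
- by rewrite hdj; case: (ltnP j 10) => ?; [|case: (ltnP j 20) => ?]; lia.
- apply: funext => t; apply: funext => n; rewrite cl hdj /mixed.
  rewrite (_ : 5 * d + (j.+1 - 20) = (5 * d + (j - 20)).+1); last by lia.
  rewrite ltnS [n <= _]leq_eqVlt; case: eqP => [->|//] /=.
  rewrite /swept bwE (_ : (_ + _) %/ 5 = d); last by lia.
  by rewrite (_ : (_ + _) %% 5 = j - 20) //; lia.
- by move=> i t ij; apply: bw; lia.
Qed.

Let mid_last C d c : mid C d 24 c -> mid C d.+1 0 (step c).
Proof.
move=> [b [cj hd cl bw]].
have [b' [b'b ->]] := step_control (isT : 24 < 25) cj.
have {}b'b : b' = b by apply: b'b; lia.
subst b'.
have bwE : contents b = window C d by apply: contents_window => i t i10; apply: bw.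
rewrite /work_program inordK //=.
exists b; split => /=.
- by left; rewrite bwE; congr (Aux (_, _, _)); apply: val_inj; rewrite /= inordK.
- by rewrite hd /=; lia.
- apply: funext => t; apply: funext => n; rewrite cl hd /mixed /=.
  rewrite (_ : 5 * d.+1 + (0 - 20) = (5 * d + 4).+1); last by lia.
  rewrite ltnS [n <= _]leq_eqVlt (_ : 24 - 20 = 4)//; case: eqP => [->|//] /=.
  rewrite /swept bwE (_ : (_ + _) %/ 5 = d); last by lia.
  by rewrite (_ : (_ + _) %% 5 = 4) //; lia.
- by [].
Qed.

Let mid0 C (q : state (aux_state sweeper)) : q = Start \/ q = Limit -> mid C 0 0 (Config q 0 C).
Proof. by move=> qs; exists [ffun=> false]; split=> //=; right. Qed.

Let mid_halt C d c v : tr_halt (sweep_state C d) (window C d) = Some v -> mid C d 10 c ->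
  cstate (step c) = verdict _ v.
Proof.
move=> hv [b [cj hd cl bw]].
have [b' [b'b ->]] := step_control (isT : 10 < 25) cj.
have {}b'b : b' = b by apply: b'b.
subst b'.
have bwE : contents b = window C d by apply: contents_window => i t i10; apply: bw.
by rewrite /work_program inordK //= bwE hv.
Qed.

Let midN C d j c : mid C d j c -> ~ halting (cstate c).
Proof. by move=> [b [/at_controlN]]. Qed.

(** A block takes 25 steps and may halt only in its step 10; the bound stops just before the test of
    block [N]. *)
Let mid_iter C (q : state (aux_state sweeper)) N : q = Start \/ q = Limit ->
  (forall d, d < N -> tr_halt (sweep_state C d) (window C d) = None) ->
  forall i, i <= 25 * N + 10 -> mid C (i %/ 25) (i %% 25) (iter i (@step _ sweeper) (Config q 0 C)).
Proof.
move=> qs nh; elim=> [|i IHi] iN; first exact: mid0.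
have {IHi} := IHi (ltnW iN); rewrite iterS => im.
have [i24|i24] := eqVneq (i %% 25) 24.
  rewrite (_ : i.+1 %/ 25 = (i %/ 25).+1); last by lia.
  rewrite (_ : i.+1 %% 25 = 0); last by lia.
  by apply: mid_last; move: im; rewrite i24.
rewrite (_ : i.+1 %/ 25 = i %/ 25); last by lia.
rewrite (_ : i.+1 %% 25 = (i %% 25).+1); last by lia.
apply: mid_step => //; first by lia.
by move=> i10; apply: nh; lia.
Qed.

Section Run.
Variable x : k.-tuple real.
Local Notation runx := (@run k sweeper Om x).

Let run_iter u i : runx (rk u i) = iter i (@step _ sweeper) (runx (rk u 0)).
Proof. by elim: i => //= i <-; rewrite (runS _ _ (osuc_is_osucc _)). Qed.

Lemma sweep_halt u q C d v : q = Start \/ q = Limit -> runx (rk u 0) = Config q 0 C ->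
  (forall e, e < d -> tr_halt (sweep_state C e) (window C e) = None) ->
  tr_halt (sweep_state C d) (window C d) = Some v ->
  (forall i, i <= 25 * d + 10 -> ~ halting (cstate (runx (rk u i)))) /\
  cstate (step (runx (rk u (25 * d + 10)))) = verdict _ v.
Proof.
move=> qs r0 nh hv; have H := mid_iter qs nh; split=> [i id|].
  by rewrite run_iter r0; apply: midN (H i id).
have H' := H _ (leqnn _); move: H'.
rewrite run_iter r0 (_ : (_ + _) %/ 25 = d); last by lia.
rewrite (_ : (_ + _) %% 25 = 10); last by lia.
exact: mid_halt.
Qed.

Lemma sweep_cells u q C : q = Start \/ q = Limit -> runx (rk u 0) = Config q 0 C ->
  (forall d, tr_halt (sweep_state C d) (window C d) = None) ->
  (forall i, ~ halting (cstate (runx (rk u i)))) /\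
  forall t n, exists N, forall i, cells (runx (rk u i)) t n = if i < N then C t n else swept C t n.
Proof.
move=> qs r0 nh.
have H i : mid C (i %/ 25) (i %% 25) (iter i (@step _ sweeper) (Config q 0 C)).
  by apply: (@mid_iter C q i) => //; lia.
split=> [i|t n]; first by rewrite run_iter r0; apply: midN (H i).
(* Cell [n] is rewritten in step [20 + n %% 5] of its block, and not again during the sweep. *)
exists (25 * (n %/ 5) + 20 + (n %% 5).+1) => i; rewrite run_iter r0.
have [b [_ _ -> _]] := H i; rewrite /mixed.
by case: (ltnP n) => h1; case: (ltnP i) => h2 //; exfalso; lia.
Qed.

(** Every cell is constant from some step of the sweep on, so its [limsup] is the rewritten
    value. *)
Lemma sweep_limit u q C : q = Start \/ q = Limit -> runx (rk u 0) = Config q 0 C ->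
  (forall d, tr_halt (sweep_state C d) (window C d) = None) ->
  runx (rk (osuc u) 0) = Config Limit 0 (swept C).
Proof.
move=> qs r0 nh; have [_ cl] := sweep_cells qs r0 nh.
rewrite run_limit; last by apply: omul_limit; exact: osuc_gt0.
congr (Config _ _); apply: funext => t; apply: funext => n.
have [N cN] := cl t n; apply/asboolP/idP => [h|sn r /lt_rk0[v [j [/olt_osuc vu ->]]]].
  have [|s [Ns /lt_rk0[v [j [/olt_osuc vu sE]]]]] := h (rk u N).
    by apply/rk_lt; left; exact: (osuc_is_osucc u).1.
  move: Ns; rewrite sE => /rk_le[uv|[uv Nj]].
    by have /olt_irr := ole_olt_trans vu uv.
  by rewrite -uv cN ltnNge Nj.
exists (rk u (maxn N j)); split.
- by apply/rk_le; case: vu => [|->]; [left|right; split=> //; lia].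
- by apply/rk_lt; left; exact: (osuc_is_osucc u).1.
- by rewrite cN ltnNge leq_maxl.
Qed.

End Run.
End Sweep.

(** * Checking a kernel *)

Fixpoint any_below (p : pred nat) (m : nat) : bool :=
  if m is m'.+1 then any_below p m' || p m' else false.

Lemma any_belowP (p : pred nat) m : reflect (exists2 i, i < m & p i) (any_below p m).
Proof.
elim: m => [|m IHm] /=; first by constructor=> -[].
apply: (iffP orP) => [[/IHm[i im pi]|pm]|[i]].
- by exists i => //; exact: ltnW.
- by exists m.
- rewrite ltnS leq_eqVlt => /orP[/eqP->|im] pi; first by right.
  by left; apply/IHm; exists i.
Qed.

(* Comparison [(x < y, y < x)] of the ordinals [x] and [y] of types [cm] and [cd],
    from the comparisons of: the predecessor of [x] with [y] ([up]), [x] with the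
    predecessor of [y] ([left]), and the two predecessors ([both]). *)
Definition compare_step (cm cd up left both : bool * bool) : bool * bool :=
  if ~~ cm.1 then
    if ~~ cd.1 then (false, false) else if ~~ cd.2 then (true, false) else left
  else if ~~ cm.2 then
    if ~~ cd.1 then (false, true) else if ~~ cd.2 then both else (up.1, ~~ up.1)
  else
    if ~~ cd.1 then up else if ~~ cd.2 then (~~ left.2, left.2) else both.

Local Arguments olt : simpl never.

Definition compare_ord (s t : Om) : bool * bool := (`[< olt s t >], `[< olt t s >]).

Definition typed (c : bool * bool) (t p : Om) : Prop :=
  t = if c.1 then if c.2 then omul p else osuc p else ozero.

(** [osuc] and [omul] are strictly increasing, and [s + 1 < omega * t] iff [s < omega * t]. As
    [omul] may yield zero, comparing it with zero is left to its predecessor. *)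
Lemma compare_stepE cm cd s s' t t' up left both :
  typed cm s s' -> typed cd t t' ->
  (cm.1 -> up = compare_ord s' t) -> (cd.1 -> left = compare_ord s t') ->
  (cm.1 -> cd.1 -> both = compare_ord s' t') ->
  compare_step cm cd up left both = compare_ord s t.
Proof.
have E (p q p' q' : Prop) : (p <-> p') -> (q <-> q') -> (`[< p >], `[< q >]) = (`[< p' >], `[< q' >]).
  by move=> pp qq; rewrite (asbool_equiv_eq pp) (asbool_equiv_eq qq).
have N (p q : Prop) : (p <-> ~ q) -> `[< p >] = ~~ `[< q >].
  by move=> pq; rewrite (asbool_equiv_eq pq) asbool_neg.
have tr (p : Prop) : p -> true = `[< p >] by move=> hp; apply/esym/asboolP.
have fl (p : Prop) : ~ p -> false = `[< p >] by move=> hp; apply/esym/asboolPn.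
have osuc_nlt (p q : Om) : olt p (osuc q) <-> ~ olt q p.
  by rewrite olt_osuc nolt.
have n0 (p : Om) : ~ olt p ozero by exact: olt0.
have s0 (p : Om) : olt ozero (osuc p) by exact: osuc_gt0.
rewrite /typed /compare_step /compare_ord.
case: cm => [[] []] /= ->; case: cd => [[] []] /= -> hu hl hb.
- by rewrite hb//; apply: E; rewrite omul_lt.
- by rewrite hl//=; congr (_, _); [rewrite (N _ _ (osuc_nlt _ _))|apply: asbool_equiv_eq; rewrite osuc_omul_lt].
- by rewrite hu//; congr (_, _); [rewrite -!fl|apply: asbool_equiv_eq; rewrite omul_gt0].
- by rewrite hu//; congr (_, _); [rewrite -!fl|apply: asbool_equiv_eq; rewrite omul_gt0].
- by rewrite hu//=; congr (_, _); [apply: asbool_equiv_eq; rewrite osuc_omul_lt|rewrite (N _ _ (osuc_nlt _ _))].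
- by rewrite hb//; apply: E; rewrite osuc_lt.
- by congr (_, _); [exact: fl|exact: tr].
- by congr (_, _); [exact: fl|exact: tr].
- by rewrite hl//; congr (_, _); [apply: asbool_equiv_eq; rewrite omul_gt0|rewrite -!fl].
- by congr (_, _); [exact: tr|exact: fl].
- by congr (_, _); exact: fl.
- by congr (_, _); exact: fl.
- by rewrite hl//; congr (_, _); [apply: asbool_equiv_eq; rewrite omul_gt0|rewrite -!fl].
- by congr (_, _); [exact: tr|exact: fl].
- by congr (_, _); exact: fl.
- by congr (_, _); exact: fl.
Qed.

(** * The transducer that checks a claimed kernel *)

Section Checker.
Variable pol : bool.

Local Notation tX := (Input (ord0 : 'I_2)).
Local Notation tY := (Input (ord_max : 'I_2)).

(* Final sweep, first sweep, type and label of the row, comparisons with the previous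
    column of the row and of the row before; [None] at the leftmost block. *)
Definition cstate_type : finType :=
  option (bool * bool * (bool * bool) * bool * (bool * bool) * (bool * bool))%type.

(** The leftmost block recovers the row data from the tapes. Of the two flags on [Output], none is
    set in the first sweep and both are set in the final one. *)
Definition context (s : cstate_type) (w : nat -> tape 2 -> bool) :=
  if s is Some c then (false, c) else
  let first := ~~ w 3 Output && ~~ w 4 Output in
  (true, (w 3 Output && w 4 Output, first,
     if first then (false, false) else (w 0 Scratch, w 1 Scratch),
     if first then w 0 tY else w 2 Scratch, (false, false), (false, false))).

Definition new_compare (s : cstate_type) (w : nat -> tape 2 -> bool) : bool * bool :=
  let: (lft, (_, _, cm, _, prv, both)) := context s w in
  compare_step cm (if lft then (false, false) else (w 0 tX, w 1 tX))
    (w 0 Output, w 1 Output) prv both.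

Definition check_next (s : cstate_type) (w : nat -> tape 2 -> bool) : cstate_type :=
  let: (_, (fin, first, cm, bm, _, _)) := context s w in
  Some (fin, first, cm, bm, new_compare s w, (w 0 Output, w 1 Output)).

(** [w 5] to [w 8] belong to the next block: tracks 2 and 3 of [x] and the row data on [Scratch]
    thus move one block to the left. [Output] keeps the comparisons for the next row and, on track
    2, records the excluded vertices. *)
Definition check_out (s : cstate_type) (w : nat -> tape 2 -> bool) (r : nat) (t : tape 2) : bool :=
  let: (lft, (fin, first, cm, bm, prv, both)) := context s w in
  let c := new_compare s w in
  if fin then
    match t with Scratch => (r == 4) || w r t | _ => w r t end
  else
    match t with
    | Input i => if i == ord0 then
        nth false [:: w 0 t; w 1 t; w 7 t; w 8 t; w 4 t] r else w r t
    | Scratch => nth false [:: if first then w 5 tX else w 5 t;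
        if first then w 6 tX else w 6 t; if first then w 5 tY else w 7 t;
        w 3 t || lft && w 3 tX && bm; w 4 t] r
    | Output => nth false [:: c.1; c.2; w 2 t || w 2 tX && c.1 && bm;
        if lft then ~~ w 3 t else w 3 t; if lft then w 3 t else w 4 t] r
    end.

(* Track 4 of [Scratch] is set by the final sweep, after which the machine halts at once;
   before it, track 3 of [Scratch] tells if a marked vertex of the kernel was met. *)
Definition check_halt (s : cstate_type) (w : nat -> tape 2 -> bool) : option bool :=
  let: (lft, (fin, _, _, _, _, _)) := context s w in
  if lft && w 4 Scratch then Some (w 3 Scratch == pol)
  else if fin && (w 0 tY != w 4 tX && ~~ w 2 Output) then Some false else None.

Definition checker : transducer 2 := @Transducer 2 cstate_type None check_next check_out check_halt.

Variables x y : real.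
Let b := track 0 y.

(** A lower neighbour [m] of [d] in the set claimed by the witness, which excludes [d] from a
    kernel. *)
Definition killer d m := track 2 x (m + d) && `[< olt (onode x m) (onode x d) >] && b m.
Definition hit m := track 3 x m && b m.

(* Contents before sweep [m].  Tracks 3 and 4 of [Output] flip in each sweep, so that they
   are both set at stage [omega ^ 2] only. *)
Definition matrix (m : nat) (t : tape 2) (n : nat) : bool :=
  let d := n %/ 5 in let r := n %% 5 in
  match t with
  | Input i => if i == ord0 then
      if (r == 2) || (r == 3) then track r x (m + d) else x n
    else y n
  | Scratch => if m is 0 then false else
      nth false [:: track 0 x (m + d); track 1 x (m + d); b (m + d);
        (d == 0) && any_below hit m; false] r
  | Output => if m is m'.+1 then
      let c := compare_ord (onode x m') (onode x d) in
      nth false [:: c.1; c.2; any_below (killer d) m; (d == 0) && odd m; (d == 0) && ~~ odd m] r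
    else false
  end.

Let colE d r : r < 5 -> ((5 * d + r) %/ 5 = d) * ((5 * d + r) %% 5 = r).
Proof. by move=> r5; split; lia. Qed.

Let windowE m d r t : r < 5 -> window (matrix m) d r t = matrix m t (5 * d + r).
Proof. by move=> r5; rewrite /window (leq_trans r5). Qed.

Let windowSE m d r t : r < 5 -> window (matrix m) d (5 + r) t = matrix m t (5 * d.+1 + r).
Proof. by move=> r5; rewrite /window (_ : 5 + r < 10); [congr matrix; lia|lia]. Qed.

Let matrixX m d r : r < 5 -> matrix m tX (5 * d + r) =
  track r x (if (r == 2) || (r == 3) then m + d else d).
Proof. by move=> r5; rewrite /matrix !colE //=; case: ifP. Qed.

Let matrixY m d r : matrix m tY (5 * d + r) = track r y d.
Proof. by []. Qed.

Let matrixS m d r : r < 5 -> matrix m Scratch (5 * d + r) = (0 < m) &&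
  nth false [:: track 0 x (m + d); track 1 x (m + d); b (m + d); (d == 0) && any_below hit m; false] r.
Proof. by move=> r5; rewrite /matrix !colE //; case: m. Qed.

Let matrixO m d r : r < 5 -> matrix m Output (5 * d + r) = (0 < m) &&
  let c := compare_ord (onode x m.-1) (onode x d) in
  nth false [:: c.1; c.2; any_below (killer d) m; (d == 0) && odd m; (d == 0) && ~~ odd m] r.
Proof. by move=> r5; rewrite /matrix !colE //; case: m. Qed.

Let matrixE := (matrixX, matrixY, matrixS, matrixO).

Let wE m d t := (@windowE m d 0 t isT, @windowE m d 1 t isT, @windowE m d 2 t isT,
  @windowE m d 3 t isT, @windowE m d 4 t isT, @windowSE m d 0 t isT, @windowSE m d 1 t isT,
  @windowSE m d 2 t isT, @windowSE m d 3 t isT).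

(** Vertex 0 has ordinal zero whatever its tracks say. *)
Let ctype m : bool * bool := if m == 0 then (false, false) else (track 0 x m, track 1 x m).

Let typed_ctype m : typed (ctype m) (onode x m) (onode x m.-1).
Proof. by rewrite /typed /ctype; case: m. Qed.

Let before m d : bool * bool :=
  if m is m'.+1 then compare_ord (onode x m') (onode x d) else (false, false).

Let beforeE m d : (window (matrix m) d 0 Output, window (matrix m) d 1 Output) = before m d.
Proof. by rewrite !wE !matrixE //; case: m. Qed.

Let state_at m d : cstate_type := sweep_state checker (matrix m) d.

Let context_at m d := context (state_at m d) (window (matrix m) d) =
  (d == 0, (false, m == 0, ctype m, b m,
    if d is d'.+1 then compare_ord (onode x m) (onode x d') else (false, false),
    if d is d'.+1 then before m d' else (false, false))).

Let compare_at m d : context_at m d ->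
  new_compare (state_at m d) (window (matrix m) d) = compare_ord (onode x m) (onode x d).
Proof.
rewrite /context_at /new_compare => ->; rewrite beforeE.
have -> : (if d == 0 then (false, false) else (window (matrix m) d 0 tX, window (matrix m) d 1 tX))
    = ctype d by rewrite !wE !matrixE.
apply: (compare_stepE (typed_ctype m) (typed_ctype d)).
- by rewrite /ctype; case: m.
- by rewrite /ctype; case: d.
- by rewrite /ctype; case: m => //; case: d.
Qed.

(** Moving right along a row, the comparison just made becomes the [left] argument of the next one,
    and the old entry of [Output] becomes [both]. *)
Let contextE m d : context_at m d.
Proof.
elim: d => [|d IHd].
  rewrite /context_at /= !wE !matrixE // /ctype /= addn0.
  by case: m => [|m] //; rewrite ltn0Sn !andTb; case: (odd m.+1).
rewrite /context_at /state_at /= /check_next IHd /= beforeE.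
by rewrite (compare_at IHd).
Qed.

Let swept_matrix m : swept checker (matrix m) = matrix m.+1.
Proof.
apply: funext => t; apply: funext => n.
rewrite [in RHS](divn_eq n 5) [in RHS]mulnC /swept.
have := ltn_pmod n (isT : 0 < 5); set d := n %/ 5; set r := n %% 5 => r5.
rewrite /= /check_out contextE (compare_at (contextE m d)).
case: t => [i||].
- case: (eqVneq i ord0) => [->|i0]; last first.
    by rewrite windowE // /matrix (negbTE i0).
  by rewrite matrixX //; case: r r5 => [|[|[|[|[|r]]]]] //= _;
    rewrite !wE !matrixE //= addnS addSn.
- rewrite matrixS //; case: r r5 => [|[|[|[|[|r]]]]] //= _; rewrite !wE !matrixE //=.
  + by case: (m) => // m'; rewrite addnS addSn.
  + by case: (m) => // m'; rewrite addnS addSn.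
  + by case: (m) => // m'; rewrite addnS addSn.
  + by case: (d) => [|d']; rewrite ?andbF //= addn0; case: (m).
  + by rewrite andbF.
- rewrite matrixO //; case: r r5 => [|[|[|[|[|r]]]]] //= _; rewrite !wE !matrixE //=.
  + by case: (m).
  + by case: (d) => [|d'] /=; rewrite ?andbF //; case: (m) => //= m'; rewrite negbK.
  + by case: (d) => [|d'] /=; rewrite ?andbF //; case: (m) => //= m'; rewrite negbK.
Qed.

Let no_halt m d : tr_halt (sweep_state checker (matrix m) d) (window (matrix m) d) = None.
Proof.
rewrite /= /check_halt contextE !wE !matrixE //=.
by rewrite !andbF.
Qed.

Let fin m : Om := iter m osuc ozero.
Local Notation runx := (@run 2 (sweeper checker) Om [tuple x; y]).

Let run_finite m : exists2 q : state (aux_state (sweeper checker)),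
  q = Start \/ q = Limit & runx (rk (fin m) 0) = Config q 0 (matrix m).
Proof.
elim: m => [|m [q qs IHm]]; last first.
  exists Limit; first by right.
  by rewrite (sweep_limit qs IHm (no_halt m)) swept_matrix.
exists Start; first by left.
rewrite /rk /= omul0 run0; last exact: ozero_is_ozero.
congr (Config _ _); apply: funext => t; apply: funext => n; case: t => [[[|[|//]] lti]||] //=.
by case: ifP => // _; rewrite /track add0n; congr x; lia.
Qed.

(** This is [omega], so [rk w1 0] is stage [omega ^ 2]; sweep [m] starts at [rk (fin m) 0], which is
    [omega * m]. *)
Let w1 := omul (osuc ozero).

Let below_w1 v : olt v w1 -> exists m, v = fin m.
Proof.
move=> /(@lt_rk0 v (osuc ozero))[u [j [/olt_osuc u0 ->]]]; exists j.
by case: u0 => [/olt0//|->]; rewrite /rk omul0.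
Qed.

Let finE m : fin m = rk ozero m.
Proof. by rewrite /rk omul0. Qed.

Let fin_w1 m : olt (fin m) w1.
Proof.
rewrite finE; apply/(@rk_lt ozero m (osuc ozero) 0); left; exact: osuc_gt0.
Qed.

Let lt_w1 m i : olt (rk (fin m) i) (rk w1 0).
Proof. by apply/rk_lt; left. Qed.

Let fin_le m m' : ole (fin m) (fin m') <-> m <= m'.
Proof.
rewrite (finE m) (finE m'); apply: (iff_trans (rk_le _ _ _ _)).
by split=> [[/olt_irr|[]]|]; auto.
Qed.

(** Within a sweep a cell is either old or new, so the [limsup] at [omega ^ 2] can be computed from
    [matrix] alone. *)
Let run_fin_cells m i t n :
  cells (runx (rk (fin m) i)) t n = matrix m t n \/ cells (runx (rk (fin m) i)) t n = matrix m.+1 t n.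
Proof.
have [q qs r0] := run_finite m; have [_ /(_ t n)[N ->]] := sweep_cells qs r0 (no_halt m).
by rewrite swept_matrix; case: ifP; [left|right].
Qed.

(* Contents at stage [omega ^ 2]. *)
Let final (t : tape 2) (n : nat) : bool := cells (runx (rk w1 0)) t n.

Let run_w1 : runx (rk w1 0) = Config Limit 0 final.
Proof.
have l : is_olimit (rk w1 0) by apply: omul_limit; apply/omul_gt0/osuc_gt0.
by rewrite /final run_limit.
Qed.

Let finalP t n : final t n <->
  forall m, exists m' i, m <= m' /\ cells (runx (rk (fin m') i)) t n.
Proof.
have l : is_olimit (rk w1 0) by apply: omul_limit; apply/omul_gt0/osuc_gt0.
rewrite /final run_limit //=; split=> [/asboolP h m|h].
  have [|s [ms /lt_rk0[v [i [/below_w1[m' ->] sE]]] cs]] := h (rk (fin m) 0).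
    exact: lt_w1.
  exists m', i; rewrite -sE; split=> //; apply/fin_le.
  by move: ms; rewrite sE => /rk_le[|[-> _]]; [left|right].
apply/asboolP => r /lt_rk0[v [j [/below_w1[m ->] ->]]].
have [m' [i [mm' c]]] := h m.+1; exists (rk (fin m') i); split=> //.
  by apply/rk_le; left; apply/(olt_ole_trans (osuc_is_osucc (fin m)).1)/(fin_le m.+1).
Qed.

Let final_stable t n v m : (forall m', m <= m' -> matrix m' t n = v) -> final t n = v.
Proof.
move=> mv; apply/idP/idP => [/finalP/(_ m)[m' [i [mm']]]|vt].
  by case: (run_fin_cells m' i t n) => ->; rewrite mv//; exact: leqW.
apply/finalP => m0; exists (maxn m m0), 0; rewrite leq_maxr; split=> //.
by case: (run_fin_cells (maxn m m0) 0 t n) => ->; rewrite mv //; lia.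
Qed.

Let final_recurrent t n : (forall m, exists2 m', m <= m' & matrix m' t n) -> final t n.
Proof.
move=> rec; apply/finalP => m; have [m' mm' c] := rec m.
exists m', 0; split=> //; have [q qs ->] := run_finite m'.
by [].
Qed.

(** The bounded search is monotone in the bound, hence eventually constant. *)
Let any_final (p : pred nat) : exists m, forall m', m <= m' ->
  any_below p m' = `[< exists i, p i >].
Proof.
have [[i pi]|np] := pselect (exists i, p i).
  exists i.+1 => m' im'; rewrite (asboolT (ex_intro _ i pi)).
  by apply/any_belowP; exists i.
exists 0 => m' _; rewrite (asboolF np); apply/negP => /any_belowP[i _ pi].
by apply: np; exists i.
Qed.

Let killed d := `[< exists m, killer d m >].

Let final_killed d : final Output (5 * d + 2) = killed d.
Proof.
have [m mE] := any_final (killer d); apply: (@final_stable _ _ _ m.+1) => m' mm'.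
by rewrite matrixO // (leq_ltn_trans (leq0n _) mm') /= mE//; exact: ltnW.
Qed.

Let final_hit : final Scratch 3 = `[< exists m, hit m >].
Proof.
have [m mE] := any_final hit; apply: (@final_stable _ _ _ m.+1) => m' mm'.
by rewrite (matrixS m' 0 (isT : 3 < 5)) (leq_ltn_trans (leq0n _) mm') /= mE//; exact: ltnW.
Qed.

Let final_flag r : (r == 3) || (r == 4) -> final Output r.
Proof.
(* An odd row for track 3, an even one for track 4. *)
move=> r34; apply: final_recurrent => m; exists (m.*2.+1 + (r - 3)).
  by rewrite -addnn; lia.
case/orP: r34 => /eqP->.
  by rewrite (matrixO _ 0 (isT : 3 < 5)) /= addn0 /= odd_double.
by rewrite (matrixO _ 0 (isT : 4 < 5)) /= addn1 /= odd_double.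
Qed.

Let final_done : final Scratch 4 = false.
Proof. by apply: (@final_stable _ _ _ 0) => m' _; rewrite (matrixS m' 0 (isT : 4 < 5)) /= andbF. Qed.

Let final_Y d : final tY (5 * d + 0) = b d.
Proof. by apply: (@final_stable _ _ _ 0) => m' _; rewrite matrixY. Qed.

Let final_X d : final tX (5 * d + 4) = track 4 x d.
Proof. by apply: (@final_stable _ _ _ 0) => m' _; rewrite matrixX. Qed.

Let final_context d : exists first cm bm prv both,
  context (sweep_state checker final d) (window final d) =
    (d == 0, (true, first, cm, bm, prv, both)).
Proof.
elim: d => [|d [first [cm [bm [prv [both cE]]]]]].
  by rewrite /= /window /= !final_flag //=; do 5!eexists.
by rewrite /= /check_next cE /=; do 5!eexists.
Qed.

Let final_halt d : tr_halt (sweep_state checker final d) (window final d) =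
  if b d != track 4 x d && ~~ killed d then Some false else None.
Proof.
have [first [cm [bm [prv [both cE]]]]] := final_context d.
rewrite /= /check_halt cE /= -final_killed -final_Y -final_X /window /=.
case: (eqVneq d 0) => [->|//] /=.
by rewrite final_done.
Qed.

Let swept_final r : r < 5 -> swept checker final Scratch r = (r == 4) || final Scratch r.
Proof.
move=> r5; rewrite /swept divn_small // modn_small //.
have [first [cm [bm [prv [both cE]]]]] := final_context 0.
by rewrite /= /check_out cE /= /window muln0 add0n (leq_trans r5).
Qed.

Let kernelP : kernel x b <-> forall d, b d = track 4 x d && ~~ killed d.
Proof.
have kE d : (forall m, lower x m d -> ~ b m) <-> ~~ killed d.
  split=> [h|/asboolP h m [hm lm] bm]; last first.
    by apply: h; exists m; rewrite /killer hm bm andbT; apply/asboolP.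
  by apply/asboolPn => -[m /andP[/andP[hm /asboolP lm] bm]]; exact: (h m).
split=> h d.
- by apply/idP/andP => [/h[xd /kE]|[xd /kE nk]]; [|apply/h].
- by rewrite kE (h d); split => /andP.
Qed.

(** The sweep from [omega ^ 2] rejects at the first vertex violating the kernel equation. Otherwise
    it sets the done mark, and the next sweep, from [omega ^ 2 + omega], gives its verdict in its
    first block. *)
Lemma checker_halts : exists t v,
  [/\ olt t (rk (osuc (osuc w1)) 0), halts_in [tuple x; y] t (verdict (aux_state (sweeper checker)) v)
    & v <-> kernel x b /\ `[< exists m, hit m >] = pol].
Proof.
have halting_verdict v : halting (verdict (aux_state (sweeper checker)) v).
  by rewrite /halting; case: v; [left|right].
have lt_fin m i : ~ halting (cstate (runx (rk (fin m) i))).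
  have [q qs r0] := run_finite m; exact: (sweep_cells qs r0 (no_halt m)).1.
have L : (Limit : state (aux_state (sweeper checker))) = Start \/
    (Limit : state (aux_state (sweeper checker))) = Limit by right.
have w2 := (osuc_is_osucc w1).1; have w3 := (osuc_is_osucc (osuc w1)).1.
have [[d0 bad0]|good] := pselect (exists d, b d != track 4 x d && ~~ killed d).
  (* The least violation is taken because no earlier block may halt. *)
  have [d bad dmin] := @ex_minnP (fun d => b d != track 4 x d && ~~ killed d) (ex_intro _ d0 bad0).
  have [||nh hv] := @sweep_halt _ checker [tuple x; y] w1 Limit final d false L run_w1.
  - move=> e ed; rewrite final_halt ifN //; apply/negP => /dmin; lia.
  - by rewrite final_halt bad.
  exists (rk w1 (25 * d + 10)), false; split.
  - by apply/rk_lt; left; exact: olt_trans w2 w3.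
  - apply/halts_inE; split=> // s; have [v [j ->]] := rk_surj s => /rk_le[vw|[-> jd]].
    + by have [m ->] := below_w1 vw.
    + exact: nh.
  - by split=> // -[/kernelP kb _]; rewrite kb eqxx in bad.
have {}good d : b d = track 4 x d && ~~ killed d.
  by apply/eqP; apply: contrapT => /negP bad; apply: good; exists d.
have nh d : tr_halt (sweep_state checker final d) (window final d) = None.
  by rewrite final_halt -good eqxx.
have [n1 _] := sweep_cells L run_w1 nh.
have r2 := sweep_limit L run_w1 nh.
have h2 : tr_halt (sweep_state checker (swept checker final) 0) (window (swept checker final) 0) =
    Some (`[< exists m, hit m >] == pol).
  have := swept_final (isT : 4 < 5); have := swept_final (isT : 3 < 5).
  rewrite final_hit; move: (swept _ _) => C /= C3 C4.
  by rewrite /= /check_halt /= /window /= muln0 !add0n C3 C4.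
have [//|n2 hv] := @sweep_halt _ checker [tuple x; y] (osuc w1) Limit _ 0 _ L r2 _ h2.
exists (rk (osuc w1) 10), (`[< exists m, hit m >] == pol); split.
- by apply/rk_lt; left.
- apply/halts_inE; split=> // s; have [v [j ->]] := rk_surj s => /rk_le[|[-> jd]]; last exact: n2.
  by move=> /olt_osuc[/below_w1[m ->]|->]; [exact: lt_fin|exact: n1].
- by split=> [/eqP|[_ ->]]//; split=> //; exact/kernelP.
Qed.

End Checker.

(** * Membership in [NP] and the separation *)

Lemma diag_NP : NP_ Om diag /\ NP_ Om (~` diag).
Proof.
suff main pol : NP_ Om (if pol then diag else ~` diag) by split; [exact: (main true)|exact: (main false)].
exists (sweeper (checker pol)), (rk (osuc (osuc (omul (osuc ozero)))) 0); split=> [x|x y]; last first.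
  have [t [v [tb ht _]]] := checker_halts pol x y.
  by exists t, (verdict _ v).
have diagE z : kernel x (track 0 z) ->
    (`[< exists m, hit x z m >] = pol <-> (if pol then diag else ~` diag) x).
  move=> kz; have dE : diag x <-> exists m, hit x z m.
    rewrite (diagP kz); split=> -[m]; first by move=> [h1 h2]; exists m; rewrite /hit h1.
    by move=> /andP[h1 h2]; exists m.
  case: (pol); split.
  - by move=> /asboolP/dE.
  - by move=> /dE/asboolP.
  - by move=> /negbT/asboolPn nh /dE.
  - by move=> nd; apply/negbTE/asboolPn => /dE.
split=> [Ax|[z acc]].
  (* Each block of the witness repeats one bit of the kernel, so that track 0 is the kernel. *)
  have [b kb] := kernel_exists x; pose z n := b (n %/ 5).
  have zb : track 0 z = b by apply: funext => d; rewrite /track /z; congr b; lia.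
  have kz : kernel x (track 0 z) by rewrite zb.
  exists z; have [t [v [_ ht vE]]] := checker_halts pol x z; exists t.
  have : v by apply/vE; split=> //; exact/diagE.
  by move=> v1; rewrite v1 in ht.
have [t [v [_ ht vE]]] := checker_halts pol x z; case: acc => t' ht'.
have [_ va] := halts_in_inj ht ht'.
have : v by move: va; rewrite /verdict; case: (v).
by move=> /vE[kz /(diagE _ kz)].
Qed.

Theorem theorem3p1 : P `<=` NP `&` coNP /\ P <> NP `&` coNP.
Proof.
split; first by move=> A /P_NP.
move=> PE; apply: diag_notin_P; rewrite PE; have [dNP cNP] := diag_NP.
by split=> //; exists (~` diag); rewrite ?setCK.
Qed.
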